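(* Let $E/k$ be a finite field extension of degree $d$. Let $(\alpha_1,\dots,\alpha_n)$ be a minimal family of generators of $E/k$, with associated presentation $E=k[t_1,\dots,t_n]/(f_1,\dots,f_n)$, and let $$w=(\bar f_1\wedge\dots\wedge\bar f_n)^*\otimes(dt_1\wedge\dots\wedge dt_n)\in\omega_{E/k}.$$ Then one has in $\mathrm K^{MW}_0(k)=\mathrm{GW}(k)$: $$ \mathrm{Tr}^{MW}_{E/k}(\langle 1\rangle\otimes w)=d_\epsilon . $$
   Context: $\mathrm{GW}(k)$ is the Grothendieck group of inner product spaces over $k$ (finite dimensional vector spaces with a non-degenerate symmetric bilinear form); $\langle u\rangle$ is the class of $(x,y)\mapsto uxy$. For $d\ge0$, $d_\epsilon=\sum_{i=0}^{d-1}\langle -1\rangle^i$ (so $d_\epsilon=m h$ if $d=2m$ and $mh+1$ if $d=2m+1$, $h=\langle1\rangle+\langle-1\rangle$). Presentation: $t_i\mapsto\alpha_i$, and $f_i\in k[t_1,\dots,t_i]$ is monic in $t_i$ and lifts the minimal polynomial of $\alpha_i$ over $k[\alpha_1,\dots,\alpha_{i-1}]$; $I=(f_1,\dots,f_n)$ is the kernel of $k[t_1,\dots,t_n]\to E$. Canonical module: $\omega_{E/k}$ is the determinant of the cotangent complex of $E/k$, canonically isomorphic to the one-dimensional $E$-vector space $\Lambda^n_E(I/I^2)^\vee\otimes_{k[\underline t]}\Omega^n_{k[\underline t]/k}$. Transfer in degree $0$: let $\mathrm{Tr}^\omega_{E/k}:\omega_{E/k}\to k$ be the differential trace map of Grothendieck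 duality: for $f:\mathrm{Spec}\,E\to\mathrm{Spec}\,k$ it is obtained from the canonical purity isomorphism $\omega_{E/k}\simeq f^!(k)$ and the counit $f_*f^!k\to k$. It is compatible with composition: $\mathrm{Tr}^\omega_{E/k}$ corresponds to $\mathrm{Tr}^\omega_{K'/k}\circ(\mathrm{Tr}^\omega_{E/K'}\otimes\mathrm{Id})$ under the canonical isomorphism $\omega_{E/k}\simeq\omega_{E/K'}\otimes_{K'}\omega_{K'/k}$ for $k\subset K'\subset E$; and for $E=k[\alpha]=k[t]/(f)$ monogenic of degree $d$, $\mathrm{Tr}^\omega_{E/k}(b\cdot\bar f^*\otimes dt)=\tau(b)$ with $\tau$ the $k$-linear form such that $\tau(\alpha^{d-1})=1$, $\tau(\alpha^i)=0$ for $0\le i<d-1$. Then $\mathrm{Tr}^{MW}_{E/k}:\mathrm K^{MW}_0(E,\omega_{E/k})=\mathrm{GW}(E,\omega_{E/k})\to\mathrm{GW}(k)$ sends the class of an $\omega_{E/k}$-valued non-degenerate symmetric bilinear form $\Phi$ to the class of $\mathrm{Tr}^\omega_{E/k}\circ\Phi$; $\langle1\rangle\otimes w$ is the class of $E\otimes_EE\to\omega_{E/k}$, $(x,y)\mapsto xy\cdot w$. *)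

(* Defs.v *)
From HB Require Import structures.
From mathcomp Require Import all_boot all_order all_algebra all_field.
From mathcomp Require Import generic_quotient ssrAC.
From mathcomp Require Import boolp functions.
From mathcomp Require Import ring.

Set Implicit Arguments.
Unset Strict Implicit.
Unset Printing Implicit Defensive.

Import GRing.Theory.
Local Open Scope ring_scope.
Local Open Scope quotient_scope.

Section Grothendieck.
Variable M : nmodType.

Definition groth_rel (p q : M * M) : bool :=
  `[< exists u, p.1 + q.2 + u = q.1 + p.2 + u >].

Fact groth_rel_refl : reflexive groth_rel.
Proof. by move=> p; apply/asboolP; exists 0. Qed.

Fact groth_rel_sym : symmetric groth_rel.
Proof. by move=> p q; apply/asboolP/asboolP => -[u eq_u]; exists u. Qed.

Fact groth_rel_trans : transitive groth_rel.
Proof.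
move=> q p r /asboolP[u equ] /asboolP[v eqv]; apply/asboolP.
exists (q.2 + u + (q.1 + v)).
transitivity ((p.1 + q.2 + u) + (q.1 + r.2 + v)).
  by rewrite !addrA [LHS](ACl (1*3*4*5*2*6)).
by rewrite equ eqv !addrA [LHS](ACl (4*2*5*3*1*6)).
Qed.

Canonical groth_equiv :=
  EquivRel groth_rel groth_rel_refl groth_rel_sym groth_rel_trans.

Definition groth := {eq_quot groth_rel}.
HB.instance Definition _ := Choice.on groth.
HB.instance Definition _ := Quotient.on groth.

Definition groth_of (x : M) : groth := \pi_groth (x, 0).

Lemma groth_ind (P : groth -> Prop) :
  (forall p, P (\pi_groth p)) -> forall x, P x.
Proof. by move=> Pp x; rewrite -[x]reprK; apply: Pp. Qed.

Lemma grothP (p q : M * M) :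
  reflect (exists u, p.1 + q.2 + u = q.1 + p.2 + u)
          (\pi_groth p == \pi_groth q).
Proof.
rewrite -[_ == _]/(\pi_{eq_quot groth_rel} p == \pi_{eq_quot groth_rel} q).
by rewrite eqmodE; apply: asboolP.
Qed.

Lemma groth_repr (p : M * M) :
  exists u, (repr (\pi_groth p)).1 + p.2 + u = p.1 + (repr (\pi_groth p)).2 + u.
Proof. by apply/grothP; rewrite reprK. Qed.

Definition groth_zero : groth := \pi_groth (0, 0).
Definition groth_opp (x : groth) : groth := \pi_groth ((repr x).2, (repr x).1).
Definition groth_add (x y : groth) : groth :=
  \pi_groth ((repr x).1 + (repr y).1, (repr x).2 + (repr y).2).

Lemma groth_oppE (p : M * M) : groth_opp (\pi_groth p) = \pi_groth (p.2, p.1).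
Proof.
apply/eqP/grothP => /=; have [u equ] := groth_repr p; exists u.
by rewrite [_ + p.1]addrC [p.2 + _]addrC.
Qed.

Lemma groth_addE (p q : M * M) :
  groth_add (\pi_groth p) (\pi_groth q) = \pi_groth (p.1 + q.1, p.2 + q.2).
Proof.
apply/eqP/grothP => /=.
have [u equ] := groth_repr p; have [v eqv] := groth_repr q.
exists (u + v).
set a := repr _ in equ *; set b := repr _ in eqv *.
transitivity ((a.1 + p.2 + u) + (b.1 + q.2 + v)).
  by rewrite !addrA [LHS](ACl (1*3*5*2*4*6)).
by rewrite equ eqv !addrA [LHS](ACl (1*4*2*5*3*6)).
Qed.

Fact groth_addA : associative groth_add.
Proof.
by move=> x y z; elim/groth_ind: x => p; elim/groth_ind: y => q;
  elim/groth_ind: z => r; rewrite !groth_addE /= !addrA.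
Qed.

Fact groth_addC : commutative groth_add.
Proof.
by move=> x y; elim/groth_ind: x => p; elim/groth_ind: y => q;
  rewrite !groth_addE addrC [p.2 + _]addrC.
Qed.

Fact groth_add0 : left_id groth_zero groth_add.
Proof. by move=> x; elim/groth_ind: x => -[p1 p2]; rewrite /groth_zero groth_addE /= !add0r. Qed.

Fact groth_addN : left_inverse groth_zero groth_opp groth_add.
Proof.
move=> x; elim/groth_ind: x => -[p1 p2]; rewrite groth_oppE groth_addE; apply/eqP/grothP => /=.
by exists 0; rewrite !addr0 add0r addrC.
Qed.

HB.instance Definition _ :=
  GRing.isZmodule.Build groth groth_addA groth_addC groth_add0 groth_addN.

Lemma groth_ofD : {morph groth_of : x y / x + y}.
Proof. by move=> x y; rewrite [RHS]groth_addE /= addr0. Qed.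

Lemma groth_of_eqP x y :
  reflect (exists u, x + u = y + u) (groth_of x == groth_of y).
Proof. by apply: (iffP (grothP _ _)) => -[u]; exists u; rewrite /= !addr0 in p *. Qed.

(* For additive h, the morphism extending h; see groth_lift_of. *)
Definition groth_lift (G : zmodType) (h : M -> G) (x : groth) : G :=
  h (repr x).1 - h (repr x).2.

Lemma groth_lift_of (G : zmodType) (h : M -> G) (x : M) :
  h 0 = 0 -> {morph h : x y / x + y} -> groth_lift h (groth_of x) = h x.
Proof.
move=> h0 hD; have [u] := groth_repr (x, 0); rewrite /= addr0 -/(groth_of x).
move=> /(congr1 h); rewrite !hD => /addIr equ.
by rewrite /groth_lift equ addrK.
Qed.

End Grothendieck.

Section GrothendieckRing.
Variable M : comPzSemiRingType.
Implicit Types x y : groth M.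

Definition groth_one : groth M := groth_of 1.
Definition groth_mul x y : groth M :=
  \pi_(groth M) ((repr x).1 * (repr y).1 + (repr x).2 * (repr y).2,
       (repr x).1 * (repr y).2 + (repr x).2 * (repr y).1).

Lemma groth_mulE (p q : M * M) :
  groth_mul (\pi_(groth M) p) (\pi_(groth M) q) =
  \pi_(groth M) (p.1 * q.1 + p.2 * q.2, p.1 * q.2 + p.2 * q.1).
Proof.
have [u equ] := groth_repr p; have [v eqv] := groth_repr q.
rewrite /groth_mul; set a := repr _ in equ *; set b := repr _ in eqv *.
transitivity (\pi_(groth M) (p.1 * b.1 + p.2 * b.2, p.1 * b.2 + p.2 * b.1)).
  apply/eqP/grothP => /=; exists (u * (b.1 + b.2)).
  transitivity ((a.1 + p.2 + u) * b.1 + (p.1 + a.2 + u) * b.2); first by ring.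
  rewrite equ; transitivity ((p.1 + a.2 + u) * b.1 + (a.1 + p.2 + u) * b.2);
    by [rewrite equ | ring].
apply/eqP/grothP => /=; exists (v * (p.1 + p.2)).
transitivity (p.1 * (b.1 + q.2 + v) + p.2 * (q.1 + b.2 + v)); first by ring.
rewrite eqv.
transitivity (p.1 * (q.1 + b.2 + v) + p.2 * (b.1 + q.2 + v));
  by [rewrite eqv | ring].
Qed.

Fact groth_mulA : associative groth_mul.
Proof.
move=> x y z; elim/groth_ind: x => p; elim/groth_ind: y => q;
  elim/groth_ind: z => r; rewrite !groth_mulE /=.
by congr (\pi_(groth M) (_, _)); ring.
Qed.

Fact groth_mulC : commutative groth_mul.
Proof.
by move=> x y; elim/groth_ind: x => p; elim/groth_ind: y => q;
  rewrite !groth_mulE; congr (\pi_(groth M) (_, _)); ring.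
Qed.

Fact groth_mul1 : left_id groth_one groth_mul.
Proof.
by move=> x; elim/groth_ind: x => -[p1 p2]; rewrite groth_mulE /=;
  congr (\pi_(groth M) (_, _)); ring.
Qed.

Fact groth_mulD : left_distributive groth_mul +%R.
Proof.
move=> x y z; elim/groth_ind: x => p; elim/groth_ind: y => q; elim/groth_ind: z => r.
rewrite -[RHS]/(groth_add _ _) -[_ + _]/(groth_add _ _).
by rewrite groth_addE !groth_mulE groth_addE /=;
  congr (\pi_(groth M) (_, _)); ring.
Qed.

HB.instance Definition _ := GRing.Zmodule_isComPzRing.Build (groth M)
  groth_mulA groth_mulC groth_mul1 groth_mulD.

Lemma groth_ofM : {morph @groth_of M : x y / x * y}.
Proof.
by move=> x y; rewrite [RHS]groth_mulE; congr (\pi_(groth M) (_, _)) => /=; ring.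
Qed.

Lemma groth_of1 : groth_of (1 : M) = 1. Proof. by []. Qed.

End GrothendieckRing.

Section InnerProducts.
Variables (K : fieldType) (L : lmodType K).

(* For L = K^o these are the usual inner products. In general L is meant to be *)
(* one-dimensional, so that injectivity of V -> Hom(V, L) is nondegeneracy.    *)
Record inner_product (V : vectType K) (b : V -> V -> L) : Prop := InnerProduct {
  ip_linear : forall a x y z, b (a *: x + y) z = a *: b x z + b y z;
  ip_sym : forall x y, b x y = b y x;
  ip_nondeg : forall x, (forall y, b x y = 0) -> x = 0 }.

Definition isometric (V W : vectType K) (b : V -> V -> L) (c : W -> W -> L) :=
  exists f : V -> W,
    [/\ linear f, bijective f & forall x y, c (f x) (f y) = b x y].

Definition ip_sum (V W : vectType K) (b : V -> V -> L) (c : W -> W -> L)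
  (x y : (V * W)%type) : L := b x.1 y.1 + c x.2 y.2.

Section FormTheory.
Variables (V : vectType K) (b : V -> V -> L).
Hypothesis ipb : inner_product b.

Lemma ipDl x y z : b (x + y) z = b x z + b y z.
Proof. by rewrite -[x in LHS]scale1r (ip_linear ipb) scale1r. Qed.
Lemma ip0l z : b 0 z = 0.
Proof. by apply: (addrI (b 0 z)); rewrite -ipDl !addr0. Qed.
Lemma ipZl a x z : b (a *: x) z = a *: b x z.
Proof. by rewrite -[a *: x]addr0 (ip_linear ipb) ip0l addr0. Qed.
Lemma ipDr x y z : b z (x + y) = b z x + b z y.
Proof. by rewrite ![b z _](ip_sym ipb) ipDl. Qed.
Lemma ip0r z : b z 0 = 0. Proof. by rewrite (ip_sym ipb) ip0l. Qed.
Lemma ipZr a x z : b z (a *: x) = a *: b z x.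
Proof. by rewrite ![b z _](ip_sym ipb) ipZl. Qed.
Lemma ip_suml I r (P : pred I) (F : I -> V) z :
  b (\sum_(i <- r | P i) F i) z = \sum_(i <- r | P i) b (F i) z.
Proof. by apply: (big_morph (b^~ z)) => [x y|]; rewrite ?ipDl ?ip0l. Qed.
Lemma ip_sumr I r (P : pred I) (F : I -> V) z :
  b z (\sum_(i <- r | P i) F i) = \sum_(i <- r | P i) b z (F i).
Proof. by apply: (big_morph (b z)) => [x y|]; rewrite ?ipDr ?ip0r. Qed.
End FormTheory.

Section IsometryTheory.
Variables (V V' W W' U : vectType K).
Variables (b : V -> V -> L) (b' : V' -> V' -> L).
Variables (c : W -> W -> L) (c' : W' -> W' -> L) (e : U -> U -> L).

Lemma isometric_refl : isometric b b.
Proof. by exists id; split=> //; exists id. Qed.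

Lemma isometric_sym : isometric b c -> isometric c b.
Proof.
move=> [f [lin_f [g fK gK] f_iso]]; exists g; split.
- by move=> a x y; apply: (can_inj fK); rewrite lin_f !gK.
- by exists f.
- by move=> x y; rewrite -f_iso !gK.
Qed.

Lemma isometric_trans : isometric b c -> isometric c e -> isometric b e.
Proof.
move=> [f [lin_f bij_f f_iso]] [g [lin_g bij_g g_iso]].
exists (g \o f); split=> [a x y /=||x y /=].
- by rewrite lin_f lin_g.
- exact: bij_comp.
- by rewrite g_iso f_iso.
Qed.

Lemma isometric_sum :
  isometric b b' -> isometric c c' -> isometric (ip_sum b c) (ip_sum b' c').
Proof.
move=> [f [lf [f' fK f'K] fi]] [g [lg [g' gK g'K] gi]].
exists (fun x => (f x.1, g x.2)); split=> /=.
- by move=> a x y /=; rewrite lf lg.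
- by exists (fun x => (f' x.1, g' x.2)) => -[x y] /=; rewrite ?fK ?gK ?f'K ?g'K.
- by move=> x y; rewrite /ip_sum /= fi gi.
Qed.

Lemma ip_sumP : inner_product b -> inner_product c -> inner_product (ip_sum b c).
Proof.
move=> ipb ipc; split=> [a x y z|x y|x x0].
- by rewrite /ip_sum (ip_linear ipb) (ip_linear ipc) scalerDr addrACA.
- by rewrite /ip_sum (ip_sym ipb) (ip_sym ipc).
- case: x x0 => x1 x2 x0; congr (_, _).
    apply: (ip_nondeg ipb) => y; have := x0 (y, 0).
    by rewrite /ip_sum /= (ip0r ipc) addr0.
  apply: (ip_nondeg ipc) => y; have := x0 (0, y).
  by rewrite /ip_sum /= (ip0r ipb) add0r.
Qed.

(* A form-preserving linear map is injective by nondegeneracy. *)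
Lemma isometric_dim (f : V -> W) :
    inner_product b -> inner_product c -> linear f ->
    (forall x y, c (f x) (f y) = b x y) -> \dim {:V} = \dim {:W} ->
  isometric b c.
Proof.
move=> ipb ipc lin_f f_iso dimVW; exists f; split=> //.
pose fl : {linear V -> W} := HB.pack f (GRing.isLinear.Build K V W *:%R f lin_f).
have f0 x : f x = 0 -> x = 0.
  move=> fx0; apply: (ip_nondeg ipb) => y.
  by rewrite -f_iso fx0 (ip0l ipc).
have ker0 : lker (linfun fl) == 0%VS.
  rewrite -subv0; apply/subvP=> x; rewrite memv_ker lfunE /= => /eqP/f0->.
  exact: mem0v.
have im : limg (linfun fl) = fullv.
  apply/eqP; rewrite eqEdim subvf /= -dimVW -(limg_dim_eq (f := linfun fl)) //.
  by rewrite (eqP ker0) capv0.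
exists (linfun fl)^-1%VF => x.
  by have := lker0_lfunK ker0 x; rewrite lfunE.
have := limg_lfunVK (f := linfun fl) (x := x).
by rewrite im lfunE => /(_ (memvf x)).
Qed.

Lemma isometric_dimE : isometric b c -> \dim {:V} = \dim {:W}.
Proof.
move=> [f [lin_f [g fK gK] _]].
pose fl : {linear V -> W} := HB.pack f (GRing.isLinear.Build K V W *:%R f lin_f).
have ker0 : lker (linfun fl) == 0%VS.
  apply/lker0P=> x y; rewrite lfunE [RHS]lfunE; exact: (can_inj fK).
rewrite -(limg_dim_eq (f := linfun fl)) ?(eqP ker0) ?capv0 //.
congr (\dim _); apply/eqP; rewrite eqEsubv subvf /=; apply/subvP=> x _.
apply/memv_imgP; exists (g x); first exact: memvf.
exact: esym (etrans (lfunE fl _) (gK _)).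
Qed.

End IsometryTheory.

(* Isometry classes: every inner product space is isometric to one whose      *)
(* underlying space is some K ^ n, which keeps the type of classes small.     *)
Record ips := Ips {
  ips_dim : nat;
  ips_form : 'rV[K]_ips_dim -> 'rV[K]_ips_dim -> L;
  ips_axiom : inner_product ips_form }.

HB.instance Definition _ := gen_eqMixin ips.
HB.instance Definition _ := gen_choiceMixin ips.

Definition ips_rel (A B : ips) : bool :=
  `[< isometric (@ips_form A) (@ips_form B) >].

Fact ips_rel_refl : reflexive ips_rel.
Proof. by move=> A; apply/asboolP/isometric_refl. Qed.

Fact ips_rel_sym : symmetric ips_rel.
Proof. by move=> A B; apply/asboolP/asboolP; apply: isometric_sym. Qed.

Fact ips_rel_trans : transitive ips_rel.
Proof.
move=> B A C /asboolP isoAB /asboolP isoBC; apply/asboolP.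
exact: isometric_trans isoAB isoBC.
Qed.

Canonical ips_equiv := EquivRel ips_rel ips_rel_refl ips_rel_sym ips_rel_trans.

Definition isoclass := {eq_quot ips_rel}.
HB.instance Definition _ := Choice.on isoclass.
HB.instance Definition _ := Quotient.on isoclass.

Section Class.
Variables (V : vectType K) (b : V -> V -> L).
Import VectorInternalTheory.

Definition ip_coord (x y : 'rV[K]_(dim V)) : L := b (r2v x) (r2v y).

Lemma ip_coord_isometric : isometric ip_coord b.
Proof.
exists r2v; split=> [|| x y]; [exact: linearP| |by []].
exact: Bijective (@r2vK K V) (@v2rK K V).
Qed.

Lemma ip_coordP : inner_product b -> inner_product ip_coord.
Proof.
move=> ipb; split=> [a x y z|x y|x x0].
- by rewrite /ip_coord linearP (ip_linear ipb).
- exact: ip_sym ipb _ _.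
- apply: (can_inj r2vK); rewrite linear0; apply: (ip_nondeg ipb) => y.
  by rewrite -[y]v2rK; apply: x0.
Qed.


End Class.

Fact ips0P : inner_product (fun _ _ : 'rV[K]_0 => 0 : L).
Proof. by split=> // [*|x _]; rewrite ?scaler0 ?addr0 ?[x]thinmx0. Qed.

(* The isometry class of b, with the zero space as junk value. *)
Definition ip_class (V : vectType K) (b : V -> V -> L) : isoclass :=
  if pselect (inner_product b) is left ipb then \pi_isoclass (Ips (ip_coordP ipb))
  else \pi_isoclass (Ips ips0P).

Lemma ip_class_eq (V W : vectType K) (b : V -> V -> L) (c : W -> W -> L) :
    inner_product b -> inner_product c ->
  ip_class b = ip_class c <-> isometric b c.
Proof.
move=> ipb ipc; rewrite /ip_class.
case: pselect => // {}ipb; case: pselect => // {}ipc.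
split=> [/(eqmodP ips_equiv)/asboolP | ] iso_bc.
  apply: isometric_trans (isometric_sym _) (isometric_trans iso_bc _);
    exact: ip_coord_isometric.
apply/(eqmodP ips_equiv)/asboolP => /=.
apply: (isometric_trans (ip_coord_isometric b)).
exact: isometric_trans iso_bc (isometric_sym (ip_coord_isometric c)).
Qed.

Lemma ip_classP (x : isoclass) :
  exists (n : nat) (b : 'rV[K]_n -> 'rV[K]_n -> L),
    inner_product b /\ x = ip_class b.
Proof.
exists (ips_dim (repr x)), (@ips_form (repr x)).
have ipb := ips_axiom (repr x); split=> //.
rewrite -[LHS]reprK /ip_class; case: pselect => // {}ipb.
by apply/(eqmodP ips_equiv)/asboolP/isometric_sym/ip_coord_isometric.
Qed.

Definition isoclass_add (x y : isoclass) : isoclass :=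
  ip_class (ip_sum (@ips_form (repr x)) (@ips_form (repr y))).

Lemma repr_isometric (V : vectType K) (b : V -> V -> L) : inner_product b ->
  isometric (@ips_form (repr (ip_class b))) b.
Proof.
move=> ipb; rewrite /ip_class; case: pselect => // {}ipb.
apply: isometric_trans (ip_coord_isometric b).
apply/asboolP; rewrite -[`[< _ >]]/(ips_rel _ (Ips (ip_coordP ipb))).
by apply/(eqmodP ips_equiv); rewrite reprK.
Qed.

Lemma isoclass_addE (V W : vectType K) (b : V -> V -> L) (c : W -> W -> L) :
    inner_product b -> inner_product c ->
  isoclass_add (ip_class b) (ip_class c) = ip_class (ip_sum b c).
Proof.
move=> ipb ipc; apply/ip_class_eq; try exact: ip_sumP; last first.
  by apply: isometric_sum; apply: repr_isometric.
by apply: ip_sumP; apply: ips_axiom.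
Qed.

Fact isoclass_addA : associative isoclass_add.
Proof.
move=> x y z; have [m [b [ipb ->]]] := ip_classP x.
have [n [c [ipc ->]]] := ip_classP y; have [p [e [ipe ->]]] := ip_classP z.
have ipbc := ip_sumP ipb ipc; have ipce := ip_sumP ipc ipe.
rewrite !isoclass_addE //; apply/ip_class_eq; try exact: ip_sumP.
exists (fun x => ((x.1, x.2.1), x.2.2)); split=> //=.
  by exists (fun x => (x.1.1, (x.1.2, x.2))); [case=> ? [] | case=> -[]].
by move=> u v; rewrite /ip_sum /= addrA.
Qed.

Fact isoclass_addC : commutative isoclass_add.
Proof.
move=> x y; have [m [b [ipb ->]]] := ip_classP x.
have [n [c [ipc ->]]] := ip_classP y.
rewrite !isoclass_addE //; apply/ip_class_eq; try exact: ip_sumP.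
exists (fun x => (x.2, x.1)); split=> //=; first by exists (fun x => (x.2, x.1)); case.
by move=> u v; rewrite /ip_sum /= addrC.
Qed.

Definition isoclass_zero : isoclass := \pi_isoclass (Ips ips0P).

Lemma isoclass_zeroE : isoclass_zero = ip_class (fun _ _ : 'rV[K]_0 => 0 : L).
Proof.
rewrite /ip_class; case: pselect => [ipb|/(_ ips0P)//].
by apply/(eqmodP ips_equiv)/asboolP/isometric_sym/ip_coord_isometric.
Qed.

Fact isoclass_add0 : left_id isoclass_zero isoclass_add.
Proof.
move=> x; have [m [b [ipb ->]]] := ip_classP x.
rewrite isoclass_zeroE isoclass_addE; [|exact: ips0P|by []].
apply/ip_class_eq => //; first by apply: ip_sumP => //; apply: ips0P.
exists snd; split=> //=.
  by exists (pair 0) => [[x1 x2]|u] //=; rewrite [x1]thinmx0.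
by move=> u v; rewrite /ip_sum /= add0r.
Qed.

HB.instance Definition _ :=
  GRing.isNmodule.Build isoclass isoclass_addA isoclass_addC isoclass_add0.

Lemma ip_classD (V W : vectType K) (b : V -> V -> L) (c : W -> W -> L) :
    inner_product b -> inner_product c ->
  ip_class (ip_sum b c) = ip_class b + ip_class c.
Proof. by move=> ipb ipc; rewrite [RHS]isoclass_addE. Qed.

End InnerProducts.

Section Tensor.
Variable K : fieldType.
Local Notation form V := (V -> V -> K^o).

(* V (x) W is realised as W ^ (dim V): X stands for the sum of the e_i (x) X i *)
(* over the basis e of V.                                                     *)
Definition ip_tensor (V W : vectType K) (b : form V) (c : form W)
    (X Y : {ffun 'I_(\dim {:V}) -> W}) : K^o :=
  \sum_(i < \dim {:V}) \sum_(j < \dim {:V})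
    b (vbasis {:V})`_i (vbasis {:V})`_j * c (X i) (Y j).

Section TensorTheory.
Variables (V W : vectType K) (b : form V) (c : form W).
Hypotheses (ipb : inner_product b) (ipc : inner_product c).

Lemma ip_tensorP : inner_product (ip_tensor b c).
Proof.
split=> [a X Y Z|X Y|X X0].
- rewrite scaler_sumr -big_split; apply: eq_bigr => i _ /=.
  rewrite scaler_sumr -big_split; apply: eq_bigr => j _ /=.
  rewrite !ffunE (ip_linear ipc) mulrDr; congr (_ + _).
  by rewrite /GRing.scale /=; ring.
- rewrite /ip_tensor exchange_big; apply: eq_bigr => i _; apply: eq_bigr => j _ /=.
  by rewrite (ip_sym ipb) (ip_sym ipc).
- apply/ffunP=> i; rewrite ffunE.
  pose e := vbasis {:V}.
  have sumX0 (j : 'I_(\dim {:V})) : \sum_(i < \dim {:V}) b e`_i e`_j *: X i = 0.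
    apply: (ip_nondeg ipc) => w; rewrite (ip_suml ipc).
    rewrite -[RHS](X0 [ffun j' => if j' == j then w else 0]).
    apply: eq_bigr => i' _; rewrite (bigD1 j) //= big1 => [|j' /negPf j'j].
      by rewrite addr0 ffunE eqxx (ipZl ipc).
    by rewrite ffunE j'j (ip0r ipc) mulr0.
  apply: (fun H => etrans (coord_vbasis (memvf (X i))) H).
  apply: big1 => l _; pose u (i' : 'I_(\dim {:V})) := coord (vbasis {:W}) l (X i').
  suff /(congr1 (coord e i)) : \sum_(i' < \dim {:V}) u i' *: e`_i' = 0.
    rewrite coord_sum_free ?(basis_free (vbasisP _)) // linear0.
    by rewrite /u => ->; rewrite scale0r.
  apply: (ip_nondeg ipb) => v; rewrite (coord_vbasis (memvf v)) (ip_sumr ipb).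
  apply: big1 => j _; rewrite (ipZr ipb) (ip_suml ipb).
  have /(congr1 (coord (vbasis {:W}) l)) := sumX0 j.
  rewrite linear_sum linear0 => eq0; rewrite [X in _ *: X](_ : _ = 0) ?scaler0 //.
  rewrite -[RHS]eq0; apply: eq_bigr => i' _.
  by rewrite (ipZl ipb) linearZ /u /GRing.scale /= mulrC.
Qed.

Lemma dim_tensor :
  \dim {:{ffun 'I_(\dim {:V}) -> W}} = (\dim {:V} * \dim {:W})%N.
Proof. by rewrite [LHS]dimvf /dim /= card_ord [\dim {:W}]dimvf. Qed.

End TensorTheory.

Definition ip_pure (V W : vectType K) (v : V) (w : W) :
    {ffun 'I_(\dim {:V}) -> W} :=
  [ffun i => coord (vbasis {:V}) i v *: w].

Lemma ip_pure_linearl (V W : vectType K) (w : W) :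
  linear (fun v : V => ip_pure v w).
Proof.
move=> a x y; apply/ffunP=> i; rewrite !ffunE linearP scalerDl.
by rewrite scalerA.
Qed.

Lemma ip_pure_linearr (V W : vectType K) (v : V) :
  linear (fun w : W => ip_pure v w).
Proof.
move=> a x y; apply/ffunP=> i; rewrite !ffunE scalerDr.
by rewrite !scalerA mulrC.
Qed.

Section TensorTheory.
Variables (V W : vectType K) (b : form V) (c : form W).
Hypotheses (ipb : inner_product b) (ipc : inner_product c).

Lemma ip_tensor_pure v w v' w' :
  ip_tensor b c (ip_pure v w) (ip_pure v' w') = b v v' * c w w'.
Proof.
rewrite [v in RHS](coord_vbasis (memvf v)) [v' in RHS](coord_vbasis (memvf v')).
rewrite (ip_suml ipb) mulr_suml; apply: eq_bigr => i _.
rewrite (ip_sumr ipb) mulr_suml; apply: eq_bigr => j _.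
rewrite !ffunE (ipZl ipb) (ipZr ipb) (ipZl ipc) (ipZr ipc) /GRing.scale /=.
by ring.
Qed.

Lemma ip_tensor_sum (I J : finType) v w v' w' :
  ip_tensor b c (\sum_(i : I) ip_pure (v i) (w i))
                (\sum_(j : J) ip_pure (v' j) (w' j)) =
  \sum_i \sum_j b (v i) (v' j) * c (w i) (w' j).
Proof.
have ipt := ip_tensorP ipb ipc.
rewrite (ip_suml ipt); apply: eq_bigr => i _.
by rewrite (ip_sumr ipt); apply: eq_bigr => j _; rewrite ip_tensor_pure.
Qed.

End TensorTheory.

Lemma isometric_tensor (V V' W W' : vectType K) (b : form V) (b' : form V')
    (c : form W) (c' : form W') :
    inner_product b -> inner_product b' -> inner_product c -> inner_product c' ->
    isometric b b' -> isometric c c' ->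
  isometric (ip_tensor b c) (ip_tensor b' c').
Proof.
move=> ipb ipb' ipc ipc' isob isoc.
have [f [lf _ fi]] := isob; have [g [lg _ gi]] := isoc.
pose h (X : {ffun 'I_(\dim {:V}) -> W}) : {ffun 'I_(\dim {:V'}) -> W'} :=
  \sum_(i < \dim {:V}) ip_pure (f (vbasis {:V})`_i) (g (X i)).
apply: (@isometric_dim _ _ _ _ _ _ h); try exact: ip_tensorP.
- move=> a X Y; rewrite /h scaler_sumr -big_split; apply: eq_bigr => i _ /=.
  by rewrite !ffunE lg ip_pure_linearr.
- move=> X Y; rewrite /h ip_tensor_sum //; apply: eq_bigr => i _.
  by apply: eq_bigr => j _; rewrite fi gi.
- by rewrite !dim_tensor (isometric_dimE isob) (isometric_dimE isoc).
Qed.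

Lemma dim_prod (V W : vectType K) :
  \dim {: (V * W)%type} = (\dim {:V} + \dim {:W})%N.
Proof. by rewrite !dimvf. Qed.

Section TensorLaws.
Variables (U V W : vectType K) (e : form U) (b : form V) (c : form W).
Hypotheses (ipe : inner_product e) (ipb : inner_product b).
Hypothesis ipc : inner_product c.

Lemma isometric_tensorA :
  isometric (ip_tensor e (ip_tensor b c)) (ip_tensor (ip_tensor e b) c).
Proof.
have ipeb := ip_tensorP ipe ipb; have ipbc := ip_tensorP ipb ipc.
pose h (X : {ffun 'I_(\dim {:U}) -> {ffun 'I_(\dim {:V}) -> W}}) :=
  \sum_(p : 'I_(\dim {:U}) * 'I_(\dim {:V}))
    ip_pure (ip_pure (vbasis {:U})`_p.1 (vbasis {:V})`_p.2) (X p.1 p.2).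
apply: (@isometric_dim _ _ _ _ _ _ h); try exact: ip_tensorP.
- move=> a X Y; rewrite /h scaler_sumr -big_split; apply: eq_bigr => i _ /=.
  by rewrite !ffunE ip_pure_linearr.
- move=> X Y; rewrite /h ip_tensor_sum //.
  pose F (i : 'I_(\dim {:U})) (j : 'I_(\dim {:V}))
      (k : 'I_(\dim {:U})) (l : 'I_(\dim {:V})) := e (vbasis {:U})`_i (vbasis {:U})`_k *
    b (vbasis {:V})`_j (vbasis {:V})`_l * c (X i j) (Y k l).
  transitivity (\sum_i \sum_j \sum_k \sum_l F i j k l).
    rewrite [RHS]pair_bigA; apply: eq_bigr => p _; rewrite [RHS]pair_bigA.
    by apply: eq_bigr => q _; rewrite ip_tensor_pure.
  apply: eq_bigr => i _; rewrite exchange_big; apply: eq_bigr => k _ /=.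
  rewrite [in RHS]/ip_tensor mulr_sumr; apply: eq_bigr => j _.
  by rewrite mulr_sumr; apply: eq_bigr => l _; rewrite mulrA.
- by rewrite !dim_tensor mulnA.
Qed.

Lemma isometric_tensorC : isometric (ip_tensor b c) (ip_tensor c b).
Proof.
pose h (X : {ffun 'I_(\dim {:V}) -> W}) :=
  \sum_(i < \dim {:V}) ip_pure (X i) (vbasis {:V})`_i.
apply: (@isometric_dim _ _ _ _ _ _ h); try exact: ip_tensorP.
- move=> a X Y; rewrite /h scaler_sumr -big_split; apply: eq_bigr => i _ /=.
  by rewrite !ffunE ip_pure_linearl.
- move=> X Y; rewrite /h ip_tensor_sum //; apply: eq_bigr => i _.
  by apply: eq_bigr => j _; rewrite mulrC.
- by rewrite !dim_tensor mulnC.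
Qed.

Lemma isometric_tensorDl :
  isometric (ip_tensor (ip_sum e b) c) (ip_sum (ip_tensor e c) (ip_tensor b c)).
Proof.
have ipeb := ip_sumP ipe ipb.
pose h (X : {ffun 'I_(\dim {: (U * V)%type}) -> W}) :=
  (\sum_(i < \dim {: (U * V)%type}) ip_pure ((vbasis {: (U * V)%type})`_i).1 (X i),
   \sum_(i < \dim {: (U * V)%type}) ip_pure ((vbasis {: (U * V)%type})`_i).2 (X i)).
apply: (@isometric_dim _ _ _ _ _ _ h).
- exact: ip_tensorP.
- by apply: ip_sumP; apply: ip_tensorP.
- move=> a X Y; rewrite /h; congr (_, _) => /=; rewrite scaler_sumr -big_split;
    by apply: eq_bigr => i _ /=; rewrite !ffunE ip_pure_linearr.
- move=> X Y; rewrite /h /ip_sum !ip_tensor_sum // -big_split.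
  apply: eq_bigr => i _; rewrite -big_split; apply: eq_bigr => j _ /=.
  by rewrite -mulrDl.
- rewrite dim_tensor dim_prod mulnDl -!dim_tensor; exact: esym (dim_prod _ _).
Qed.

End TensorLaws.

Definition rank_one (u : K) (x y : K^o) : K^o := u * x * y.

Lemma rank_oneP (u : K) : u != 0 -> inner_product (rank_one u).
Proof.
move=> u0; split=> [a x y z|x y|x x0]; rewrite /rank_one.
- by rewrite /GRing.scale /=; ring.
- by rewrite mulrAC.
- apply/eqP; have /eqP := x0 1; rewrite /rank_one mulr1 mulf_eq0.
  by rewrite (negPf u0).
Qed.

Lemma isometric_tensor1 (V : vectType K) (b : form V) :
  inner_product b -> isometric (ip_tensor (rank_one 1) b) b.
Proof.
move=> ipb; have ip1 := rank_oneP (oner_neq0 K).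
pose h (X : {ffun 'I_(\dim {: K^o}) -> V}) :=
  \sum_(i < \dim {: K^o}) ((vbasis {: K^o})`_i : K) *: X i.
apply: (@isometric_dim _ _ _ _ _ _ h) => //; first exact: ip_tensorP.
- move=> a X Y; rewrite /h scaler_sumr -big_split; apply: eq_bigr => i _ /=.
  by rewrite !ffunE scalerDr !scalerA mulrC.
- move=> X Y; rewrite /h (ip_suml ipb); apply: eq_bigr => i _.
  rewrite (ip_sumr ipb); apply: eq_bigr => j _.
  by rewrite (ipZl ipb) (ipZr ipb) /rank_one /GRing.scale /=; ring.
- by rewrite dim_tensor dimvf /dim /= mul1n.
Qed.

(* The commutative semiring of isometry classes of inner product spaces. *)
Definition gwring := isoclass K^o.
HB.instance Definition _ := GRing.Nmodule.on gwring.

Implicit Types x y z : gwring.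
Definition isoclass_mul x y : gwring :=
  ip_class (ip_tensor (@ips_form _ _ (repr x)) (@ips_form _ _ (repr y))).
Definition isoclass_one : gwring := ip_class (rank_one 1).

Lemma isoclass_mulE (V W : vectType K) (b : form V) (c : form W) :
    inner_product b -> inner_product c ->
  isoclass_mul (ip_class b) (ip_class c) = ip_class (ip_tensor b c).
Proof.
move=> ipb ipc; apply/ip_class_eq; try exact: ip_tensorP; last first.
  by apply: isometric_tensor => //; [apply: ips_axiom | apply: ips_axiom
    | apply: repr_isometric | apply: repr_isometric].
by apply: ip_tensorP; apply: ips_axiom.
Qed.

Fact isoclass_mulA : associative isoclass_mul.
Proof.
move=> x y z; have [m [b [ipb ->]]] := ip_classP x.
have [n [c [ipc ->]]] := ip_classP y; have [p [e [ipe ->]]] := ip_classP z.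
have ipbc := ip_tensorP ipb ipc; have ipce := ip_tensorP ipc ipe.
rewrite (isoclass_mulE ipb ipc) (isoclass_mulE ipc ipe).
rewrite (isoclass_mulE ipb ipce) (isoclass_mulE ipbc ipe).
by apply/ip_class_eq; try exact: ip_tensorP; apply: isometric_tensorA.
Qed.

Fact isoclass_mulC : commutative isoclass_mul.
Proof.
move=> x y; have [m [b [ipb ->]]] := ip_classP x.
have [n [c [ipc ->]]] := ip_classP y.
rewrite (isoclass_mulE ipb ipc) (isoclass_mulE ipc ipb).
by apply/ip_class_eq; try exact: ip_tensorP; apply: isometric_tensorC.
Qed.

Fact isoclass_mul1 : left_id isoclass_one isoclass_mul.
Proof.
move=> x; have [m [b [ipb ->]]] := ip_classP x.
have ip1 := rank_oneP (oner_neq0 K).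
rewrite (isoclass_mulE ip1 ipb); apply/ip_class_eq => //; first exact: ip_tensorP.
exact: isometric_tensor1.
Qed.

Fact isoclass_mulDl : left_distributive isoclass_mul +%R.
Proof.
move=> x y z; have [m [b [ipb ->]]] := ip_classP x.
have [n [c [ipc ->]]] := ip_classP y; have [p [e [ipe ->]]] := ip_classP z.
have ipbc := ip_sumP ipb ipc.
have ipbe := ip_tensorP ipb ipe; have ipce := ip_tensorP ipc ipe.
rewrite (isoclass_mulE ipb ipe) (isoclass_mulE ipc ipe) -!ip_classD //.
rewrite (isoclass_mulE ipbc ipe); apply/ip_class_eq.
- exact: ip_tensorP.
- exact: ip_sumP.
- exact: isometric_tensorDl.
Qed.

Fact isoclass_mul0 : left_zero 0 isoclass_mul.
Proof.
move=> x; have [m [b [ipb ->]]] := ip_classP x.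
have ip0 := @ips0P K K^o.
rewrite -[0]/(isoclass_zero K^o) isoclass_zeroE (isoclass_mulE ip0 ipb).
apply/ip_class_eq => //; first exact: ip_tensorP.
apply: (@isometric_dim _ _ _ _ _ _ (fun=> 0)) => //; first exact: ip_tensorP.
- by move=> a X Y; rewrite scaler0 addr0.
- by move=> X Y; rewrite /ip_tensor big1 // => i _; rewrite big1 // => j _; rewrite mul0r.
- by rewrite dim_tensor !dimvf /dim /= mul0n.
Qed.

HB.instance Definition _ := GRing.Nmodule_isComPzSemiRing.Build gwring
  isoclass_mulA isoclass_mulC isoclass_mul1 isoclass_mulDl isoclass_mul0.

End Tensor.

Definition GW (K : fieldType) := groth (gwring K).
HB.instance Definition _ K := GRing.ComPzRing.on (GW K).

(* GW(K, L), for forms with values in the line L. *)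
Definition GW_line (K : fieldType) (L : lmodType K) := groth (isoclass L).
HB.instance Definition _ K L := GRing.Zmodule.on (@GW_line K L).

Definition gw (K : fieldType) (V : vectType K) (b : V -> V -> K^o) : GW K :=
  groth_of (ip_class b : gwring K).

Definition gw_line (K : fieldType) (L : lmodType K) (V : vectType K)
  (b : V -> V -> L) : GW_line L := groth_of (ip_class b).

(* <u>, for u != 0 *)
Definition gw_unit (K : fieldType) (u : K) : GW K := gw (rank_one u).

(* d_epsilon *)
Definition eps_int (K : fieldType) (d : nat) : GW K :=
  \sum_(0 <= i < d) gw_unit (-1) ^+ i.

Section RestrictionOfScalars.
Variables (k : fieldType) (E : fieldExtType k).

Definition scalar_restr (V : vectType E) : Type := V.

Section Def.
Variable V : vectType E.
Local Notation Vk := (scalar_restr V).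

HB.instance Definition _ := GRing.Zmodule.on Vk.

Definition restr_scale (a : k) (v : Vk) : Vk := (a%:A : E) *: (v : V).

Fact restr_scalerA a b v : restr_scale a (restr_scale b v) = restr_scale (a * b) v.
Proof. by rewrite /restr_scale scalerA -scalerAl mul1r scalerA. Qed.
Fact restr_scale1r : left_id 1 restr_scale.
Proof. by move=> v; rewrite /restr_scale !scale1r. Qed.
Fact restr_scalerDr : right_distributive restr_scale +%R.
Proof. by move=> a u v; apply: scalerDr. Qed.
Fact restr_scalerDl v : {morph restr_scale^~ v : a b / a + b}.
Proof. by move=> a b; rewrite /restr_scale !scalerDl. Qed.

HB.instance Definition _ := GRing.Zmodule_isLmodule.Build k Vk
  restr_scalerA restr_scale1r restr_scalerDr restr_scalerDl.

Lemma restr_scaleE (a : k) (v : Vk) : a *: v = (a%:A : E) *: (v : V) :> V.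
Proof. by []. Qed.

Import VectorInternalTheory.

Fact restr_vect_iso : Vector.axiom (dim V * dim E) Vk.
Proof.
pose f (v : Vk) := mxvec (\matrix_(i < dim V) v2r (v2r (v : V) 0 i : E)).
exists f.
  move=> a u v; rewrite -linearP; congr mxvec; apply/matrixP=> i j.
  by rewrite !mxE [v2r (_ + _)]linearP !mxE -scalerAl mul1r linearP !mxE.
pose g (r : 'rV[k]_(dim V * dim E)) : Vk :=
  r2v (\row_(i < dim V) (r2v (row i (vec_mx r)) : E)) : V.
exists g => [v|r].
  rewrite /g mxvecK -[RHS](@v2rK _ V); congr r2v; apply/rowP=> i.
  by rewrite mxE rowK v2rK.
apply: (canLR vec_mxK); apply/row_matrixP=> i.
by rewrite rowK r2vK mxE r2vK.
Qed.

HB.instance Definition _ := Lmodule_hasFinDim.Build k Vk restr_vect_iso.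
End Def.

Section Transfer.
Variables (L : lmodType E) (s : L -> k^o).

Definition transfer_form (V : vectType E) (b : V -> V -> L)
  (x y : scalar_restr V) : k^o := s (b x y).

(* The pushforward [b] |-> [s o b]. It is read off representatives, and is a     *)
(* well-defined map on classes as soon as s is k-linear and s(E u) <> 0 for     *)
(* u <> 0: see transferE.                                                       *)
Definition transfer : GW_line L -> GW k :=
  groth_lift (fun x : isoclass L => gw (transfer_form (@ips_form _ _ (repr x)))).

Hypothesis s_linear : forall a u v, s ((a%:A : E) *: u + v) = a * s u + s v.
Hypothesis s_nondeg : forall u, (forall a, s (a *: u) = 0) -> u = 0.

Lemma sD : {morph s : u v / u + v}.
Proof. by move=> u v; have := s_linear 1 u v; rewrite !scale1r mul1r. Qed.

Lemma transfer_formP (V : vectType E) (b : V -> V -> L) :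
  inner_product b -> inner_product (transfer_form b).
Proof.
move=> ipb; split=> [a x y z|x y|x x0].
- by rewrite /transfer_form restr_scaleE (ip_linear ipb) s_linear.
- by rewrite /transfer_form (ip_sym ipb).
- apply: (ip_nondeg ipb) => y; apply: s_nondeg => a.
  by rewrite -(ipZr ipb); apply: x0.
Qed.

Lemma isometric_transfer (V W : vectType E) (b : V -> V -> L) (c : W -> W -> L) :
  isometric b c -> isometric (transfer_form b) (transfer_form c).
Proof.
move=> [f [lin_f bij_f f_iso]]; exists f; split=> // [a x y|x y].
  exact: lin_f.
by rewrite /transfer_form f_iso.
Qed.

Lemma transferE (V : vectType E) (b : V -> V -> L) :
  inner_product b -> transfer (gw_line b) = gw (transfer_form b).
Proof.
pose h (x : isoclass L) := gw (transfer_form (@ips_form _ _ (repr x))).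
have hE (U : vectType E) (e : U -> U -> L) :
    inner_product e -> h (ip_class e) = gw (transfer_form e).
  move=> ipe; congr groth_of; apply/ip_class_eq.
  - exact/transfer_formP/ips_axiom.
  - exact: transfer_formP.
  - exact/isometric_transfer/repr_isometric.
have hD : {morph h : x y / x + y}.
  move=> x y; have [m [c [ipc ->]]] := ip_classP x.
  have [n [e [ipe ->]]] := ip_classP y; rewrite -ip_classD //.
  rewrite !hE //; last exact: ip_sumP.
  rewrite -groth_ofD; congr groth_of.
  have ipc' := transfer_formP ipc; have ipe' := transfer_formP ipe.
  rewrite -ip_classD //; apply/ip_class_eq.
  - exact/transfer_formP/ip_sumP.
  - exact: ip_sumP.
  exists id; split=> //; first by exists id.
  by move=> u v; rewrite /transfer_form /ip_sum sD.
have h0 : h 0 = 0 by apply: (addrI (h 0)); rewrite -hD !addr0.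
by move=> ipb; rewrite -hE //; exact: (@groth_lift_of (isoclass L) (GW k) h (ip_class b) h0 hD).
Qed.

End Transfer.
End RestrictionOfScalars.

From mathcomp Require Import mpoly.

Section CanonicalModule.
Variables (k : fieldType) (E : fieldExtType k) (n : nat) (alpha : 'I_n -> E).

(* The presentation k[t] -> E, t_i |-> alpha_i, and its kernel I. *)
Definition pres_eval : {mpoly k[n]} -> E := mmap (in_alg E) alpha.

Definition pres_ideal : Type := {p : {mpoly k[n]} | pres_eval p == 0}.

(* A k[t]-multilinear alternating map I ^ n -> E kills I ^ 2, as I acts by 0 on  *)
(* E: these maps are exactly the E-multilinear alternating n-forms on I / I^2,   *)
(* that is, the elements of the dual of Lambda^n_E (I / I^2).                    *)
Record conormal_form (eta : ('I_n -> pres_ideal) -> E^o) : Prop := ConormalForm {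
  conormal_linear : forall (i : 'I_n) (g h r : 'I_n -> pres_ideal)
      (p : {mpoly k[n]}),
    (forall j, j != i -> g j = r j /\ h j = r j) ->
    val (r i) = p * val (g i) + val (h i) ->
    eta r = pres_eval p *: eta g + eta h;
  conormal_alternate : forall (i j : 'I_n) (g : 'I_n -> pres_ideal),
    i != j -> g i = g j -> eta g = 0 }.

Definition conormal_pred : {pred ('I_n -> pres_ideal) -> E^o} :=
  [pred eta | `[< conormal_form eta >]].

Fact conormal_submod_closed : submod_closed conormal_pred.
Proof.
split=> [|a u v /asboolP[ul ua] /asboolP[vl va]]; apply/asboolP; split.
- by move=> i g h r p _ _; rewrite -[RHS]/(_ *: 0 + 0) scaler0 addr0.
- by [].
- move=> i g h r p eq_gr eq_r; rewrite -[LHS]/(a *: u r + v r).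
  rewrite -[RHS]/(_ *: (a *: u g + v g) + (a *: u h + v h)).
  by rewrite (ul i g h r p) // (vl i g h r p) // /GRing.scale /=; ring.
- move=> i j g ij gij; rewrite -[LHS]/(a *: u g + v g).
  by rewrite (ua i j) // (va i j) // scaler0 addr0.
Qed.

HB.instance Definition _ := GRing.isSubmodClosed.Build E _ conormal_pred
  conormal_submod_closed.

(* omega_{E/k} = Lambda^n_E (I / I^2)^v (x)_{k[t]} Omega^n_{k[t]/k}. Since        *)
(* Omega^n_{k[t]/k} is free on dt_1 /\ ... /\ dt_n, its elements are written in  *)
(* a unique way eta (x) (dt_1 /\ ... /\ dt_n); the record stores eta.            *)
Record omega := Omega {
  omega_fun :> ('I_n -> pres_ideal) -> E^o;
  _ : omega_fun \in conormal_pred }.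

HB.instance Definition _ := [isSub for omega_fun].
HB.instance Definition _ := gen_eqMixin omega.
HB.instance Definition _ := gen_choiceMixin omega.
HB.instance Definition _ := [SubChoice_isSubLmodule of omega by <:].

(* (f_1 /\ ... /\ f_n)^* (x) (dt_1 /\ ... /\ dt_n): the functional with value 1   *)
(* on f_1 /\ ... /\ f_n. It is unique when the f_i form a basis of I / I^2; the  *)
(* value 0 is junk.                                                             *)
Definition wedge_dual (f : 'I_n -> pres_ideal) : omega :=
  if pselect (exists eta : omega, eta f = 1) is left ex then projT1 (cid ex)
  else 0.

(* E[t] -> E[t] / I E[t] = E (x)_k E -> E, the last map being id (x) phi. *)
Definition contract (phi : 'Hom(E, k^o)) (D : {mpoly E[n]}) : E :=
  \sum_(m <- msupp D) ((phi (mmap1 alpha m) : k)%:A * D@_m).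

(* The purity isomorphism omega_{E/k} = p^!(k) = Hom_k(E, k), for p the           *)
(* composite of the regular immersion Spec E -> A^n with the smooth projection  *)
(* A^n -> Spec k, as the graph of a relation. Over E, the point alpha of A^n_E  *)
(* is cut out by the regular sequence t_j - alpha_j, where the fundamental      *)
(* local isomorphism sends (t_j - alpha_j)^* (x) dt to evaluation at alpha. For *)
(* g_1, ..., g_n in I, write g_i = \sum_j A_ij (t_j - alpha_j) in E[t]; then     *)
(* det A is the top degree part of the map from the Koszul complex of the g_i   *)
(* to that of the t_j - alpha_j, its class in E (x)_k E depends only on g, and   *)
(*                eta(g_1 /\ ... /\ g_n) = (id (x) phi)(det A).                  *)
(* For n = 1, g = f monic of degree d and A = f(t) / (t - alpha), the phi        *)
(* attached to f^* (x) dt is Euler's form: phi(alpha^i) = 0 for i < d - 1 and   *)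
(* phi(alpha^(d-1)) = 1. For a tower k < K' < E one can take A block            *)
(* triangular, so that det A is the product of the two determinants and the     *)
(* phi's compose; this is the compatibility of purity with composition under    *)
(* omega_{E/k} = omega_{E/K'} (x) omega_{K'/k}.                                  *)
Definition purity (phi : 'Hom(E, k^o)) (eta : omega) : Prop :=
  forall (g : 'I_n -> pres_ideal) (A : 'M[{mpoly E[n]}]_n),
    (forall i, map_mpoly (in_alg E) (val (g i)) =
               \sum_j A i j * ('X_j - (alpha j)%:MP)) ->
  eta g = contract phi (\det A).

(* The counit p_* p^! k -> k is evaluation at 1 on Hom_k(E, k). When alpha        *)
(* generates E, every eta corresponds to a unique phi; the value 0 is junk.     *)
Definition Tr_omega (eta : omega) : k^o :=
  if pselect (exists phi, purity phi eta) is left ex then projT1 (cid ex) 1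
  else 0.

(* K^MW_0(E, omega) = GW(E, omega) -> GW(k) *)
Definition Tr_MW : GW_line omega -> GW k := transfer Tr_omega.

(* <1> (x) w *)
Definition gen_class (w : omega) : GW_line omega :=
  gw_line (fun x y : E^o => (x * y : E) *: w).

(* The family generates E over k and no proper subfamily does. *)
Definition minimal_generators : Prop :=
  <<1 & [seq alpha i | i : 'I_n]>>%VS = fullv /\
  forall J : {set 'I_n},
    <<1 & [seq alpha i | i in J]>>%VS = fullv -> J = [set: 'I_n].

(* f_i lies in k[t_1, ..., t_i], is monic in t_i, and becomes the minimal         *)
(* polynomial of alpha_i over k[alpha_1, ..., alpha_(i-1)] when the t_j, j < i,  *)
(* are specialised to alpha_j. Then (f_1, ..., f_n) = I.                         *)
Definition presentation (f : 'I_n -> pres_ideal) : Prop :=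
  forall i : 'I_n,
  [/\ forall (j : 'I_n) m, (i < j)%N -> m \in msupp (val (f i)) -> m j = 0%N,
      exists e, forall m, m \in msupp (val (f i) - 'X_i ^+ e) -> (m i < e)%N
    & mmap (fun c : k => (c%:A : E)%:P)
           (fun j => if j == i then 'X else (alpha j)%:P) (val (f i)) =
      minPoly <<1 & [seq alpha j | j : 'I_n <- enum 'I_n & (j < i)%N]>> (alpha i)].

End CanonicalModule.

(* Main.v *)
Require Import Defs.
From HB Require Import structures.
From mathcomp Require Import all_boot all_order all_algebra all_field.
From mathcomp Require Import boolp ssrcomplements mpoly ring zify fingroup perm.

Set Implicit Arguments.
Unset Strict Implicit.
Unset Printing Implicit Defensive.

Import GRing.Theory.
Local Open Scope ring_scope.

(* Let K_r = k(alpha_1, ..., alpha_r), and let T : E -> k be the composite of    *)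
(* Euler's forms tau_r : K_r -> K_(r-1), where tau_r takes the coefficient of    *)
(* alpha_r ^ (d_r - 1). Modulo the t_j - alpha_j with j < r, the polynomial f_r  *)
(* is minPoly(t_r), so the f_r are written in terms of the t_j - alpha_j with a  *)
(* triangular matrix of determinant \prod_r minPoly(t_r) / (t_r - alpha_r).      *)
(* Contracting this determinant with T gives 1, hence purity matches w with T,   *)
(* and Tr(<1> (x) w) is the class of (x, y) |-> T (x * y).                       *)
(* On the monomials in the alpha's, ordered lexicographically with the last      *)
(* generator most significant, the Gram matrix of this form vanishes before the  *)
(* antidiagonal and is 1 on it. Splitting off the planes spanned by the first    *)
(* and last vectors shows that such a form has class d_epsilon: a plane          *)
(* [[0, 1], [1, c]] has class <1> + <-1> in every characteristic, since c can be *)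
(* removed after adding <-c>.                                                    *)

(** The transfer is governed by one k-linear form T on E, the composite of Euler's forms along the
    tower of the alpha's. On the side of purity, the contraction of a determinant expressing f is
    independent of the matrix ([contract_det_unique]), because the syzygies of the regular sequence
    t_j - alpha_j are Koszul. The triangular matrix of [presentation_det] then gives eta(f) = \sum_t
    phi(b_t) c_t whenever phi is matched with eta ([contract_presentation]), where the b_t are the
    monomials [tower_basis] in the alpha's and the c_t are the products [tower_dual] of coefficients
    of the quotients minPoly(X) / (X - alpha_i). Since T(c_t) is 1 for t = 0 and 0 otherwise,
    applying T yields phi(1) = T(eta(f)) ([purity_at1]). Since T(b_t) is 1 for the last t and 0
    otherwise, the form matched with T has value 1 on f ([euler_omega_f]). The f_i generate I
    ([pres_ideal_gen]) and an alternating form is determined by its value on generators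
    ([conormal_eq0]), so that form is w, it spans omega, and [Tr_omegaE] computes the trace. On the
    side of forms, (x, y) |-> T(x y) has an antitriangular Gram matrix in the b_t
    ([tower_basis_gram], [euler_gram]), and [gw_antitriangular] shows that the class of such a form
    depends only on its rank. *)

Section GramForms.
Variable K : fieldType.
Implicit Types (V W : vectType K) (a : nat -> nat -> K).

Lemma gw_isometric V W (b : V -> V -> K^o) (c : W -> W -> K^o) :
  inner_product b -> inner_product c -> isometric b c -> gw b = gw c.
Proof. by move=> ipb ipc bc; congr groth_of; apply/ip_class_eq. Qed.

Lemma gwD V W (b : V -> V -> K^o) (c : W -> W -> K^o) :
  inner_product b -> inner_product c -> gw (ip_sum b c) = gw b + gw c.
Proof. by move=> ipb ipc; rewrite -groth_ofD; congr groth_of; apply: ip_classD. Qed.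

Definition gram_form d a (x y : 'rV[K]_d) : K^o :=
  \sum_i \sum_j x 0 i * y 0 j * a i j.

(* The index is shifted by one so that nothing is required when d = 0. *)
Record antitriangular d a : Prop := Antitriangular {
  antitri_sym : forall i j, a i j = a j i;
  antitri0 : forall i j, ((i + j).+1 < d)%N -> a i j = 0;
  antitri1 : forall i j, (i + j).+1 = d -> a i j = 1 }.

Definition nat_delta d (i : nat) : 'rV[K]_d := \row_j (j == i :> nat)%:R.

Lemma gram_formP d a : antitriangular d a -> inner_product (@gram_form d a).
Proof.
case=> sym a0 a1; split=> [c x y z|x y|x x0].
- rewrite scaler_sumr -big_split; apply: eq_bigr => i _ /=.
  rewrite scaler_sumr -big_split; apply: eq_bigr => j _ /=.
  by rewrite !mxE /GRing.scale /=; ring.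
- rewrite /gram_form exchange_big; apply: eq_bigr => i _; apply: eq_bigr => j _.
  by rewrite sym [x 0 _ * _]mulrC.
(* The coordinates of x vanish from the last one down: in the pairing with the t-th unit vector,
   earlier coordinates meet the zeros before the antidiagonal and later ones vanish by induction. *)
have x0' t (i : 'I_d) : (i + t).+1 = d -> x 0 i = 0.
  elim/ltn_ind: t i => t IH i itd.
  have td : (t < d)%N by rewrite -itd ltnS leq_addl.
  have := x0 (nat_delta d t); rewrite /gram_form (bigD1 i) //= [X in _ + X]big1.
    rewrite addr0 (bigD1 (Ordinal td)) //= [X in _ + X]big1 => [|j jt].
      by rewrite addr0 mxE eqxx (a1 i t itd) !mulr1.
    by rewrite mxE (negPf (jt : j != t :> nat)) mulr0 mul0r.
  move=> i' ii'; apply: big1 => j _; rewrite mxE.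
  case: eqP => [->|_]; last by rewrite mulr0 mul0r.
  case: (ltngtP i' i) => [lt|lt|/val_inj eq_ii'].
  - by rewrite a0 ?mulr0 //; lia.
  - by have lti' := ltn_ord i'; rewrite (IH (d - i'.+1)%N) ?mul0r //; lia.
  - by rewrite eq_ii' eqxx in ii'.
by apply/rowP=> i; have lti := ltn_ord i; rewrite mxE (x0' (d - i.+1)%N) //; lia.
Qed.

(** The family v need not be known to be a basis: the Gram form is nondegenerate, so sending the
    unit vectors to v is injective, and the dimensions agree. *)
Lemma gram_isometric V (b : V -> V -> K^o) (v : nat -> V) d a :
    inner_product b -> \dim {:V} = d -> antitriangular d a ->
    (forall i j, (i < d)%N -> (j < d)%N -> b (v i) (v j) = a i j) ->
  isometric (@gram_form d a) b.
Proof.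
move=> ipb dimV tri_a bE.
pose f (x : 'rV[K]_d) : V := \sum_(i < d) x 0 i *: v i.
apply: (isometric_dim (f := f)) => //; first exact: gram_formP.
- move=> c x y; rewrite scaler_sumr -big_split; apply: eq_bigr => i _ /=.
  by rewrite !mxE scalerDl scalerA.
- move=> x y; rewrite (ip_suml ipb); apply: eq_bigr => i _.
  rewrite (ip_sumr ipb); apply: eq_bigr => j _.
  by rewrite (ipZl ipb) (ipZr ipb) bE // /GRing.scale /=; ring.
- by rewrite dimV dimvf /dim /= mul1n.
Qed.

(* The metabolic plane with Gram matrix [[0, 1], [1, c]]. *)
Definition plane_gram (c : K) (i j : nat) : K :=
  if (i + j)%N is s.+1 then (if s is 0 then 1 else c) else 0.

Lemma plane_gram_tri c : antitriangular 2 (plane_gram c).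
Proof.
split=> i j; rewrite /plane_gram; first by rewrite addnC.
  by case: (i + j)%N.
by case: (i + j)%N => // -[].
Qed.

Definition plane_form c := @gram_form 2 (plane_gram c).

Lemma plane_formP c : inner_product (plane_form c).
Proof. exact/gram_formP/plane_gram_tri. Qed.

Lemma plane_formE c x y : plane_form c x y =
  x 0 0 * y 0 1 + x 0 1 * y 0 0 + c * (x 0 1 * y 0 1).
Proof.
rewrite /plane_form /gram_form !big_ord_recl !big_ord0 /plane_gram /=.
have -> : lift ord0 ord0 = 1 :> 'I_2 by apply: val_inj.
by ring.
Qed.

Lemma dim_rV d : \dim {: 'rV[K]_d} = d.
Proof. by rewrite dimvf /dim /= mul1n. Qed.

Lemma dim_regular : \dim {: K^o} = 1%N.
Proof. by rewrite dimvf. Qed.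

(* Adding <-c> turns the vector of norm c into one of norm 0. *)
Lemma gw_plane_const c : gw (plane_form c) = gw (plane_form 0).
Proof.
have [->//|c0] := eqVneq c 0.
have ipr : inner_product (rank_one (- c)) by apply: rank_oneP; rewrite oppr_eq0.
have ip1 := plane_formP c; have ip0 := plane_formP 0.
apply: (addIr (gw (rank_one (- c)))); rewrite -!gwD //.
apply: gw_isometric; [exact: ip_sumP|exact: ip_sumP|].
(* With z the generator of <-c>, this map fixes e_0, sends e_1 to c e_0 + e_1 - z, of norm 2c - c =
   c, and sends z to z - c e_0. *)
pose f (p : 'rV[K]_2 * K^o) : ('rV[K]_2 * K^o)%type :=
  (\row_j (if j == 0 then p.1 0 0 + c * p.1 0 1 - c * p.2 else p.1 0 1),
   p.2 - p.1 0 1).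
apply: (isometric_dim (f := f)) => //; [exact: ip_sumP|exact: ip_sumP| |].
- move=> t [x x'] [y y']; congr (_, _) => /=; last first.
    by rewrite !mxE /GRing.scale /=; ring.
  apply/rowP=> j; rewrite !mxE /=; case: ifP => _; rewrite ?mxE //.
  by rewrite /GRing.scale /=; ring.
- by move=> [x x'] [y y']; rewrite /ip_sum /rank_one !plane_formE !mxE /=; ring.
Qed.

Lemma gw_plane c : gw (plane_form c) = 1 + gw_unit (-1).
Proof.
(* The vectors (1, 1) and (1, 0) of <1> + <-1> have Gram matrix [[0, 1], [1, 1]], whence the detour
   through c = 1. In characteristic 2 the plane with c = 0 is alternating and is not isometric to
   <1> + <-1>. *)
rewrite gw_plane_const -(gw_plane_const 1).
have ip1 := rank_oneP (oner_neq0 K).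
have ipN : inner_product (rank_one (-1 : K)).
  by apply: rank_oneP; rewrite oppr_eq0 oner_neq0.
rewrite -[1 in RHS]/(gw (rank_one 1)) -gwD //.
apply: gw_isometric; [exact: plane_formP|exact: ip_sumP|].
pose v (i : nat) : (K^o * K^o)%type := (1, (i == 0%N)%:R).
apply: (gram_isometric (v := v)).
- exact: ip_sumP.
- by rewrite dim_prod dim_regular.
- exact: plane_gram_tri.
- by case=> [|[]//] [|[]//] _ _; rewrite /ip_sum /v /rank_one /plane_gram /=; ring.
Qed.

(** The first and last vectors span a metabolic plane. A middle vector is already orthogonal to the
    first one, and subtracting [a i d.+1] times the first makes it orthogonal to the last. The first
    vector being isotropic, this leaves the middle block unchanged. *)
Lemma gram_form_step d a : antitriangular d.+2 a ->
  isometric (@gram_form d.+2 a)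
    (ip_sum (plane_form (a d.+1 d.+1))
            (@gram_form d (fun i j => a i.+1 j.+1))).
Proof.
case=> sym a0 a1; set c := a _ _; set a' := fun i j => _.
have tri' : antitriangular d a'.
  split=> i j; first exact: sym.
    by move=> ij; apply: a0; rewrite addSn addnS.
  by move=> ij; apply: a1; rewrite addSn addnS ij.
pose e i : 'rV[K]_2 := nat_delta 2 i.
pose v i : ('rV[K]_2 * 'rV[K]_d)%type :=
  if i is i'.+1 then
    if i' == d then (e 1%N, 0) else (a i d.+1 *: e 0%N, nat_delta d i')
  else (e 0%N, 0).
have ip' := gram_formP tri'; have ipc := plane_formP c.
have gramE i j : (i < d)%N -> (j < d)%N ->
    gram_form a' (nat_delta d i) (nat_delta d j) = a' i j.
  move=> id jd; rewrite /gram_form (bigD1 (Ordinal id)) //= [X in _ + X]big1.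
    rewrite addr0 (bigD1 (Ordinal jd)) //= [X in _ + X]big1 => [|j' jj'].
      by rewrite addr0 !mxE !eqxx !mul1r.
    by rewrite !mxE (negPf (jj' : j' != j :> nat)) mulr0 mul0r.
  move=> i' ii'; apply: big1 => j' _.
  by rewrite !mxE (negPf (ii' : i' != i :> nat)) !mul0r.
have [e00 e01 e11] : [/\ plane_form c (e 0%N) (e 0%N) = 0,
   plane_form c (e 0%N) (e 1%N) = 1 & plane_form c (e 1%N) (e 1%N) = c].
  by split; rewrite plane_formE !mxE /=; ring.
apply: (gram_isometric (v := v)) => //.
- exact: ip_sumP.
- by rewrite dim_prod !dim_rV.
have bS i j : (i < d)%N -> (j < d)%N ->
    ip_sum (plane_form c) (gram_form a') (v i.+1) (v j.+1) = a i.+1 j.+1.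
  move=> id jd; rewrite /ip_sum /v !ltn_eqF //= gramE // (ipZl ipc) (ipZr ipc).
  by rewrite e00 !scaler0 add0r.
have b0 i : (i < d)%N ->
    ip_sum (plane_form c) (gram_form a') (v i.+1) (v 0%N) = a i.+1 0%N.
  move=> id; rewrite /ip_sum /v ltn_eqF //= (ipZl ipc) e00 scaler0 (ip0r ip').
  by rewrite a0 ?addr0 // addn0.
have bd i : (i < d)%N ->
    ip_sum (plane_form c) (gram_form a') (v i.+1) (v d.+1) = a i.+1 d.+1.
  move=> id; rewrite /ip_sum /v eqxx ltn_eqF //= (ipZl ipc) e01 (ip0r ip').
  by rewrite addr0 /GRing.scale /= mulr1.
have ips := ip_sumP ipc ip'.
case=> [|i] [|j]; rewrite ?ltnS => id jd.
- by rewrite /ip_sum /= e00 (ip0r ip') addr0 a0.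
- move: jd; rewrite leq_eqVlt => /orP[/eqP->|jd].
    by rewrite /ip_sum /v eqxx /= e01 (ip0r ip') addr0 a1.
  by rewrite (ip_sym ips) b0 // sym.
- move: id; rewrite leq_eqVlt => /orP[/eqP->|id]; last by rewrite b0.
  by rewrite (ip_sym ips) /ip_sum /v eqxx /= e01 (ip0r ip') addr0 a1 // addn0.
- move: id jd; rewrite leq_eqVlt => /orP[/eqP->|id];
    rewrite leq_eqVlt => /orP[/eqP->|jd].
  + by rewrite /ip_sum /v eqxx /= e11 (ip0r ip') addr0.
  + by rewrite (ip_sym ips) bd // sym.
  + exact: bd.
  + exact: bS.
Qed.

Lemma gw_unitN1_sq : gw_unit (-1 : K) * gw_unit (-1) = 1.
Proof.
have ipN : inner_product (rank_one (-1 : K)).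
  by apply: rank_oneP; rewrite oppr_eq0 oner_neq0.
have ip1 := rank_oneP (oner_neq0 K).
rewrite -groth_ofM; congr groth_of.
rewrite -[_ * _]/(isoclass_mul _ _) isoclass_mulE //.
have ipt := ip_tensorP ipN ipN.
apply/ip_class_eq => //; apply: isometric_sym.
apply: (isometric_dim (f := fun x : K^o => ip_pure (1 : K^o) x)) => //.
- exact: ip_pure_linearr.
- by move=> x y; rewrite ip_tensor_pure // /rank_one; ring.
- by rewrite dim_tensor dim_regular.
Qed.

Lemma eps_intSS d : eps_int K d.+2 = 1 + gw_unit (-1) + eps_int K d.
Proof.
rewrite /eps_int big_nat_recl // big_nat_recl // expr0 expr1 addrA; congr (_ + _).
by apply: eq_bigr => i _; rewrite !exprS mulrA gw_unitN1_sq mul1r.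
Qed.

Lemma gw_antitriangular d a :
  antitriangular d a -> gw (@gram_form d a) = eps_int K d.
Proof.
elim/ltn_ind: d a => -[|[|d]] IH a tri_a.
(* The zero-dimensional form is isometric to its double, so its class is 0. *)
- rewrite /eps_int big_geq //; apply: (addIr (gw (@gram_form 0 a))).
  have ip := gram_formP tri_a.
  rewrite add0r -gwD //; apply: gw_isometric => //; first exact: ip_sumP.
  exists (fun=> 0); split=> [t x y||x y].
  + by rewrite scaler0 addr0.
  + exists (fun=> 0) => [[x y]|x]; last by rewrite [x]thinmx0.
    by rewrite [x]thinmx0 [y]thinmx0.
  + by rewrite /ip_sum [x.1]thinmx0 [x.2]thinmx0 !(ip0l ip) addr0.
- rewrite /eps_int big_nat1 expr0 -[1 in RHS]/(gw (rank_one 1)).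
  apply: gw_isometric; [exact: gram_formP|exact/rank_oneP/oner_neq0|].
  apply: (gram_isometric (v := fun=> 1 : K^o)) => //.
  + exact/rank_oneP/oner_neq0.
  + exact: dim_regular.
  + by case=> // -[] // _ _; rewrite (antitri1 tri_a) // /rank_one; ring.
- have tri' : antitriangular d (fun i j => a i.+1 j.+1).
    split=> i j; first exact: antitri_sym tri_a _ _.
      by move=> ij; apply: (antitri0 tri_a); rewrite addSn addnS.
    by move=> ij; apply: (antitri1 tri_a); rewrite addSn addnS ij.
  have ipp := plane_formP (a d.+1 d.+1); have ip' := gram_formP tri'.
  rewrite (gw_isometric _ _ (gram_form_step tri_a)); first last.
  + exact: ip_sumP.
  + exact: gram_formP.
  by rewrite gwD // gw_plane IH // eps_intSS.
Qed.

End GramForms.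

(** * Euler's form of a simple extension and the coefficients of minPoly(X) / (X - x) *)

Section EulerForm.
Variables (k : fieldType) (E : fieldExtType k) (K : {subfield E}) (x : E).
Local Notation d := (adjoin_degree K x).

(** Euler's form K(x) -> K. Off K(x) its values are junk, but being defined on all of E makes
    composites along a tower linear endomorphisms of E. *)
Definition euler (y : E) : E := (Fadjoin_poly K x y)`_d.-1.

Definition min_quo : {poly E} := minPoly K x %/ ('X - x%:P).

Lemma euler_linear : linear euler.
Proof.
move=> c u v; rewrite /euler linearP coefD; congr (_ + _).
by rewrite [_ *: _]/(_ *: _) coefZ /= mulr_algl.
Qed.

Lemma euler_mem y : euler y \in K.
Proof. exact/polyOverP/Fadjoin_polyOver. Qed.

Lemma euler_poly p :
  p \is a polyOver K -> (size p <= d)%N -> euler p.[x] = p`_d.-1.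
Proof. by move=> Kp szp; rewrite /euler (Fadjoin_poly_unique Kp szp). Qed.

Lemma euler_polyM y p : y \in K -> p \is a polyOver K -> (size p <= d)%N ->
  euler (y * p.[x]) = y * p`_d.-1.
Proof.
move=> Ky Kp szp; rewrite -hornerZ euler_poly ?coefZ //.
  by rewrite -mul_polyC rpredM ?polyOverC.
exact: leq_trans (size_scale_leq _ _) szp.
Qed.

Lemma euler_exp y s : y \in K -> (s < d)%N ->
  euler (y * x ^+ s) = y * (s == d.-1)%:R.
Proof.
move=> Ky sd; rewrite -hornerXn euler_polyM ?coefXn 1?eq_sym ?rpredX ?polyOverX //.
by rewrite size_polyXn.
Qed.

Lemma min_quoK : min_quo * ('X - x%:P) = minPoly K x.
Proof. by rewrite divpK // dvdp_XsubCl root_minPoly. Qed.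

Lemma size_min_quo : size min_quo = d.
Proof.
by rewrite size_divp ?polyXsubC_eq0 // size_XsubC size_minPoly subn1.
Qed.

Lemma min_quo_lead : min_quo`_d.-1 = 1.
Proof.
have : min_quo \is monic.
  by rewrite -(monicMr _ (monicXsubC x)) min_quoK monic_minPoly.
by rewrite monicE /lead_coef size_min_quo => /eqP.
Qed.

(** Comparing coefficients in p = b (X - x), with p = [minPoly K x] and b = [min_quo], gives
    Horner's recursion b_s = x b_(s+1) + p_(s+1), which starts from b_(d-1) = 1. *)
Lemma min_quo_coef t : (t < d)%N -> exists h : {poly E},
  [/\ h \is a polyOver K, h \is monic, size h = t.+1 & h.[x] = min_quo`_(d.-1 - t)].
Proof.
elim: t => [|t IH] td.
  exists 1; rewrite rpred1 monic1 size_poly1 subn0 min_quo_lead.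
  by rewrite hornerE.
have [h [Kh mon_h sz_h hx]] := IH (ltnW td).
exists ('X * h + ((minPoly K x)`_(d.-1 - t))%:P).
have szXh : size ('X * h) = t.+2.
  by rewrite mulrC size_mulX ?sz_h // monic_neq0.
have szC : (size (((minPoly K x)`_(d.-1 - t))%:P) < t.+2)%N.
  exact: leq_ltn_trans (size_polyC_leq1 _) _.
split.
- by rewrite rpredD ?rpredM ?polyOverX ?polyOverC // (polyOverP (minPolyOver _ _)).
- by rewrite monicE lead_coefDl ?szXh // -monicE monicMr ?monicX.
- by rewrite size_polyDl szXh.
- have st : (d.-1 - t = (d.-1 - t.+1).+1)%N by lia.
  rewrite !hornerE hx -min_quoK st; set s := (_ - _)%N.
  by rewrite mulrBr coefB coefMX coefMC /=; ring.
Qed.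

(** The coefficient b_s is a monic polynomial of degree d - 1 - s in x, so the power x^(d-1) occurs
    in it only for s = 0. *)
Lemma euler_min_quo y s : y \in K -> (s < d)%N ->
  euler (y * min_quo`_s) = y * (s == 0%N)%:R.
Proof.
move=> Ky sd; have dd : d.-1.+1 = d by [].
have [|h [Kh mon_h sz_h]] := @min_quo_coef (d.-1 - s); first by lia.
rewrite subKn; last by lia.
move=> hx; rewrite -hx euler_polyM ?sz_h //; last by lia.
have [s0|s0] := eqVneq s 0%N.
  by move: mon_h; rewrite monicE /lead_coef sz_h s0 subn0 => /eqP->.
by rewrite nth_default // sz_h; lia.
Qed.

End EulerForm.

(** * Euler's forms composed along a tower of simple extensions *)

Section Tower.
Variables (k : fieldType) (E : fieldExtType k) (a : nat -> E).

Fixpoint tower r : {subfield E} :=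
  if r is s.+1 then <<tower s; a s>>%AS else 1%AS.

Fixpoint tower_euler r (y : E) : E :=
  if r is s.+1 then tower_euler s (euler (tower s) (a s) y) else y.

(* The monomials in the a's, in lexicographic order with the last generator     *)
(* most significant, and the coefficients of the products of the min_quo's.     *)
Fixpoint tower_basis r (i : nat) : E :=
  if r is s.+1 then
    tower_basis s (i %% \dim (tower s)) * a s ^+ (i %/ \dim (tower s))
  else 1.

Fixpoint tower_dual r (i : nat) : E :=
  if r is s.+1 then
    tower_dual s (i %% \dim (tower s)) *
    (min_quo (tower s) (a s))`_(i %/ \dim (tower s))
  else 1.

Local Notation deg s := (adjoin_degree (tower s) (a s)).

Lemma tower_mem r : a r \in tower r.+1.
Proof. exact: memv_adjoin. Qed.

Lemma towerS r : (tower r <= tower r.+1)%VS.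
Proof. exact: subv_adjoin. Qed.

Lemma dim_towerS r : \dim (tower r.+1) = (deg r * \dim (tower r))%N.
Proof. exact: dim_Fadjoin. Qed.

Lemma dim_tower_gt0 r : (0 < \dim (tower r))%N.
Proof. exact: adim_gt0. Qed.

Lemma ltn_tower_div r i : (i < \dim (tower r.+1))%N ->
  (i %/ \dim (tower r) < deg r)%N.
Proof. by rewrite dim_towerS ltn_divLR // dim_tower_gt0. Qed.

Lemma ltn_tower_mod r i : (i %% \dim (tower r) < \dim (tower r))%N.
Proof. by rewrite ltn_mod dim_tower_gt0. Qed.

Lemma tower_euler_linear r : linear (tower_euler r).
Proof. by elim: r => [|r IH] c u v //=; rewrite euler_linear IH. Qed.

Lemma tower_euler0 r : tower_euler r 0 = 0.
Proof.
have := tower_euler_linear r (-1) 0 0.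
by rewrite scaler0 add0r scaleN1r addNr.
Qed.

Lemma tower_euler_mem r y : y \in tower r -> tower_euler r y \in 1%VS.
Proof. by elim: r y => [|r IH] y //= _; apply/IH/euler_mem. Qed.

Lemma tower_basis_mem r i : tower_basis r i \in tower r.
Proof.
elim: r i => [|r IH] i /=; first exact: mem1v.
by rewrite rpredM ?rpredX ?tower_mem // (subvP (towerS r)) ?IH.
Qed.

Lemma tower_dual_lead r : tower_dual r (\dim (tower r)).-1 = 1.
Proof.
elim: r => [|r IH] //; rewrite [LHS]/= dim_towerS.
have d0 := dim_tower_gt0 r; set D := \dim _ in d0 IH *.
have -> : ((deg r * D).-1 = (deg r).-1 * D + D.-1)%N.
  have -> : deg r = (deg r).-1.+1 by [].
  by rewrite mulSn succnK; move: (_.-1 * D)%N => z; lia.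
rewrite modnMDl modn_small ?prednK // divnMDl // divn_small ?prednK // addn0.
by rewrite IH min_quo_lead mulr1.
Qed.

(** By [euler_min_quo] the outer form kills an index with nonzero top digit, and otherwise leaves
    the dual element of the lower digits. *)
Lemma tower_euler_dual r i : (i < \dim (tower r))%N ->
  tower_dual r i \in tower r /\ tower_euler r (tower_dual r i) = (i == 0%N)%:R.
Proof.
elim: r i => [|r IH] i; first by rewrite dimv1 => /=; case: i => // _; rewrite mem1v.
move=> lti; have [Ku eq_u] := IH _ (ltn_tower_mod r i).
have lt_s := ltn_tower_div lti; rewrite [tower_dual _ _]/= [tower_euler _ _]/=.
split.
  apply: rpredM; first exact: (subvP (towerS r)).
  have [|h [Kh _ _]] := @min_quo_coef _ _ (tower r) (a r) ((deg r).-1 - i %/ \dim (tower r)).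
    by rewrite ltnS leq_subr.
  by rewrite (subKn (lt_s : _ <= _.-1)%N) => <-; exact: mempx_Fadjoin.
rewrite euler_min_quo //; set D := \dim _ in lt_s eq_u *.
have [s0|s0] := eqVneq (i %/ D)%N 0%N.
  rewrite mulr1 eq_u; congr (_ : bool)%:R.
  by rewrite [in RHS](divn_eq i D) s0 mul0n.
rewrite mulr0 tower_euler0; case: eqP => // i0; move: s0.
by rewrite i0 div0n.
Qed.

(** Write i = sD + i' and j = tD + j' with D the dimension of K_r and d the degree of the top step.
    As i + j < dD, also s + t < d, so the power a_r^(s+t) needs no reduction and the outer form
    gives 0 unless s + t = d - 1. In that case i' + j' compares with D - 1 as i + j does with dD -
    1, and the induction applies. *)
Lemma tower_basis_gram r i j :
  (i < \dim (tower r))%N -> (j < \dim (tower r))%N ->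
  (((i + j).+1 < \dim (tower r))%N ->
   tower_euler r (tower_basis r i * tower_basis r j) = 0) /\
  ((i + j).+1 = \dim (tower r) ->
   tower_euler r (tower_basis r i * tower_basis r j) = 1).
Proof.
elim: r i j => [|r IH] i j.
  by rewrite dimv1 => ltia ltj; split=> // _ /=; rewrite mulr1.
move=> lti ltj.
have [lt_s lt_t] := (ltn_tower_div lti, ltn_tower_div ltj).
have [lt_i lt_j] := (ltn_tower_mod r i, ltn_tower_mod r j).
have [eq0 eq1] := IH _ _ lt_i lt_j.
have Kij : tower_basis r (i %% \dim (tower r)) *
    tower_basis r (j %% \dim (tower r)) \in tower r.
  by rewrite rpredM ?tower_basis_mem.
rewrite /= mulrACA -exprD; move: lti ltj; rewrite dim_towerS.
have := divn_eq i (\dim (tower r)); have := divn_eq j (\dim (tower r)).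
move: (i %% _)%N (j %% _)%N (i %/ _)%N (j %/ _)%N lt_s lt_t lt_i lt_j eq0 eq1 Kij.
set D := \dim _; set b := tower_basis r; set d := deg r.
move=> i' j' s t lt_s lt_t lt_i lt_j eq0 eq1 Kij eq_j eq_i lti ltj.
have bound : ((i + j).+1 <= d * D -> s + t < d)%N.
  rewrite eq_i eq_j => le; rewrite -(ltn_pmul2r (dim_tower_gt0 r)) -/D.
  by apply: leq_trans le; rewrite mulnDl; lia.
have d0 : d = d.-1.+1 by [].
split=> [lt_ij | eq_ij].
  have lt_d := bound (ltnW lt_ij); rewrite euler_exp //.
  case: eqP => [st|_]; last by rewrite mulr0 tower_euler0.
  rewrite mulr1 eq0 //; move: lt_ij; rewrite eq_i eq_j -/d d0 -st mulSn.
  by rewrite mulnDl; lia.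
have lt_d := bound (eq_leq eq_ij); rewrite euler_exp //.
have st : (s + t = d.-1)%N.
  have : (d < (s + t).+2)%N.
    rewrite -(ltn_pmul2r (dim_tower_gt0 r)) -/D -eq_ij eq_i eq_j !mulSn mulnDl.
    by lia.
  by move: lt_d; rewrite d0; lia.
rewrite st eqxx mulr1 eq1 //.
by move: eq_ij; rewrite eq_i eq_j -/d d0 -st mulSn mulnDl; lia.
Qed.

Lemma tower_euler_scalar r : tower r = fullv :> {vspace E} ->
  exists T : 'Hom(E, k^o), forall y, tower_euler r y = (T y : k)%:A.
Proof.
move=> full; pose f : {linear E -> E} :=
  HB.pack (tower_euler r) (GRing.isLinear.Build _ _ _ _ _ (tower_euler_linear r)).
pose g : E -> k^o := coord [tuple (1 : E)] ord0 \o f.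
exists (linfun g) => y; rewrite lfunE /=.
have /vlineP[c eq_c] : tower_euler r y \in 1%VS.
  by apply: tower_euler_mem; rewrite full memvf.
rewrite eq_c linearZ /=.
have := @coord_free _ _ _ [tuple (1 : E)] ord0 ord0.
by rewrite /= seq1_free // oner_neq0 => -> //; congr (_ *: _); rewrite /GRing.scale /= mulr1.
Qed.

End Tower.

(** * The regular sequence t_j - alpha_j and determinants modulo an ideal *)

Section MpolyPoint.
Variables (R : idomainType) (n : nat) (alpha : 'I_n -> R).
Local Notation P := {mpoly R[n]}.
Implicit Types (p q : P) (S : pred 'I_n) (J : P -> Prop).

Definition shift (j : 'I_n) : P := 'X_j - (alpha j)%:MP.

Definition psub_var S (j : 'I_n) : P := if S j then (alpha j)%:MP else 'X_j.
Definition psub S : P -> P := mmap (@mpolyC n R) (psub_var S).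
HB.instance Definition _ S := GRing.RMorphism.copy (psub S) (mmap (@mpolyC n R) (psub_var S)).

Lemma psubC S c : psub S c%:MP = c%:MP.
Proof. exact: mmapC. Qed.

Lemma psubX S j : psub S 'X_j = psub_var S j.
Proof. by rewrite /psub mmapX mmap1U. Qed.

Lemma psub_shift S j : psub S (shift j) = if S j then 0 else shift j.
Proof.
by rewrite rmorphB /= psubX psubC /psub_var; case: ifP => // _; rewrite subrr.
Qed.

Lemma mpoly_ring_ind (Q : P -> Prop) :
    (forall c, Q c%:MP) -> (forall j, Q 'X_j) ->
    (forall p q, Q p -> Q q -> Q (p + q)) ->
    (forall p q, Q p -> Q q -> Q (p * q)) ->
  forall p, Q p.
Proof.
move=> QC QX QD QM p; rewrite (mpolyE p); elim: (msupp p) => [|m s IH].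
  by rewrite big_nil -(mpolyC0 n); apply: QC.
rewrite big_cons; apply: QD => //; rewrite -mul_mpolyC; apply: (QM) => //.
rewrite mpolyXE_id; elim: (index_enum _) => [|j r IHr].
  by rewrite big_nil -(mpolyC1 n); apply: QC.
rewrite big_cons; apply: (QM) => //; elim: (m j) => [|e IHe].
  by rewrite expr0 -(mpolyC1 n); apply: QC.
by rewrite exprS; apply: QM.
Qed.

(** For S everything this writes a polynomial vanishing at alpha over the t_j - alpha_j. Partial S
    serves the induction on syzygies and the triangular matrix of the presentation. *)
Lemma psub_decomp S p : exists s : 'I_n -> P,
  (forall j, ~~ S j -> s j = 0) /\ p = psub S p + \sum_j s j * shift j.
Proof.
move: p; apply: mpoly_ring_ind => [c|j|p q|p q].
- exists (fun=> 0); split=> //; rewrite psubC big1 ?addr0 // => j _.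
  by rewrite mul0r.
- exists (fun j' => (S j && (j' == j))%:R); split.
    by move=> j' Sj'; case: eqP => [jj'|]; rewrite ?andbF // -jj' (negPf Sj').
  rewrite (bigD1 j) //= big1 => [|j' /negPf->]; last by rewrite andbF mul0r.
  rewrite eqxx andbT addr0 psubX /psub_var; case: (S j).
    by rewrite mul1r addrC subrK.
  by rewrite mul0r addr0.
- move=> [s [s0 eq_p]] [t [t0 eq_q]].
  exists (fun j => s j + t j); split=> [j Sj|]; first by rewrite s0 ?t0 ?addr0.
  rewrite rmorphD /= [X in X + _ = _]eq_p [X in _ + X = _]eq_q addrACA.
  congr (_ + _); rewrite -big_split.
  by apply: eq_bigr => j _; rewrite mulrDl.
- move=> [s [s0 eq_p]] [t [t0 eq_q]].
  exists (fun j => s j * q + psub S p * t j); split=> [j Sj|].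
    by rewrite s0 ?t0 // mul0r mulr0 addr0.
  rewrite rmorphM /= [X in X * _ = _]eq_p mulrDl.
  rewrite [X in _ * X + _ = _]eq_q mulrDr -addrA; congr (_ + _).
  rewrite mulr_sumr mulr_suml -big_split; apply: eq_bigr => j _ /=.
  by ring.
Qed.

Lemma psubT p : psub xpredT p = (p.@[alpha])%:MP.
Proof.
move: p; apply: mpoly_ring_ind => [c|j|p q eq_p eq_q|p q eq_p eq_q].
- by rewrite psubC mevalC.
- by rewrite psubX mevalXU.
- by rewrite rmorphD /= eq_p eq_q mevalD mpolyCD.
- by rewrite rmorphM /= eq_p eq_q mevalM mpolyCM.
Qed.

Record is_ideal J : Prop := IsIdeal {
  ideal0 : J 0;
  idealD : forall p q, J p -> J q -> J (p + q);
  idealM : forall p q, J q -> J (p * q) }.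

Section Ideal.
Variable J : P -> Prop.
Hypothesis idJ : is_ideal J.

Lemma ideal_sum I r (Q : pred I) F :
  (forall i, Q i -> J (F i)) -> J (\sum_(i <- r | Q i) F i).
Proof.
move=> JF; apply: big_rec => [|i p Qi Jp]; first exact: ideal0 idJ.
by apply: idealD => //; apply: JF.
Qed.

(* Syzygies of the regular sequence t_j - alpha_j are Koszul; the hypothesis on *)
(* c says that the functional u |-> \sum_j u j * c j sends Koszul syzygies to J. *)
Lemma koszul_syzygy (u c : 'I_n -> P) :
    (forall j l, J (shift l * c j - shift j * c l)) ->
    \sum_j u j * shift j = 0 ->
  J (\sum_j u j * c j).
Proof.
move=> Jc.
suff claim r : (r <= n)%N -> forall u : 'I_n -> P,
    (forall j : 'I_n, (r <= j)%N -> u j = 0) ->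
    \sum_j u j * shift j = 0 -> J (\sum_j u j * c j).
  by apply: (claim n (leqnn n)) => j; rewrite leqNgt ltn_ord.
elim: r => [|r IH] ltrn {}u u0 ux.
  by rewrite big1 => [|j _]; [exact: ideal0 idJ | rewrite u0 ?mul0r].
pose i := Ordinal ltrn; pose S (j : 'I_n) := (j < r)%N.
have [s [s0 eq_u]] := psub_decomp S (u i).
(* Specialising t_j to alpha_j for j < r reduces the syzygy to its last term, so u_i specialises to
   0 and u_i = \sum_j s_j (t_j - alpha_j) over j < r. *)
have : psub S (\sum_j u j * shift j) = 0 by rewrite ux rmorph0.
rewrite rmorph_sum (bigD1 i) //= big1 => [|j ji]; last first.
  rewrite rmorphM /= psub_shift; case: (ltnP j r) => [ltjr|lerj].
    by rewrite /S ltjr mulr0.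
  by rewrite u0 ?rmorph0 ?mul0r // ltn_neqAle eq_sym ji.
rewrite rmorphM /= psub_shift [S i]ltnn addr0 => /eqP.
have shift_neq0 : shift i != 0.
  apply/eqP=> /(congr1 (mcoeff U_(i))); rewrite mcoeffB mcoeffC mcoeff0.
  rewrite mcoeffX eqxx mnm1_eq0 mulr0 subr0 => /eqP.
  by rewrite oner_eq0.
rewrite mulf_eq0 (negPf shift_neq0) orbF => /eqP u_i0.
rewrite u_i0 add0r in eq_u.
(* Adding the Koszul syzygies between i and the j < r, with coefficients s_j, clears the coordinate
   i of u. *)
pose u' j := u j - (j == i)%:R * u i + s j * shift i.
have sum_delta (F : 'I_n -> P) : \sum_j (j == i)%:R * u i * F j = u i * F i.
  rewrite (bigD1 i) //= eqxx mul1r big1 ?addr0 // => j /negPf->.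
  by rewrite !mul0r.
have sum_u' (F : 'I_n -> P) : \sum_j u' j * F j =
    \sum_j u j * F j - u i * F i + \sum_j s j * shift i * F j.
  rewrite -sum_delta -sumrB -big_split; apply: eq_bigr => j _ /=.
  by rewrite /u'; ring.
have Ju' : J (\sum_j u' j * c j).
  apply: (IH (ltnW ltrn)) => [j lerj|].
    rewrite /u' s0 -?leqNgt // mul0r addr0.
    have [->|ji] := eqVneq j i; first by rewrite mul1r subrr.
    by rewrite mul0r subr0 u0 // ltn_neqAle eq_sym ji.
  rewrite sum_u' ux sub0r {1}eq_u mulr_suml -sumrN -big_split.
  by apply: big1 => j _ /=; ring.
have -> : \sum_j u j * c j =
    \sum_j u' j * c j + \sum_j s j * (shift j * c i - shift i * c j).
  rewrite sum_u' {1}eq_u mulr_suml -!addrA -sumrN -!big_split /=.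
  apply: eq_bigr => j _.
  by ring.
apply: (idealD idJ) => //; apply: ideal_sum => j _.
exact: idealM.
Qed.

Definition mul_shift (A : 'M[P]_n) (i : 'I_n) : P := \sum_j A i j * shift j.

Lemma cramer_shift (A : 'M[P]_n) (l : 'I_n) :
  \sum_i cofactor A i l * mul_shift A i = \det A * shift l.
Proof.
have /matrixP/(_ l)/= := mul_adj_mx A => adjA.
transitivity (\sum_j ((\det A)%:M : 'M_n) l j * shift j).
  transitivity (\sum_i \sum_j cofactor A i l * (A i j * shift j)).
    by apply: eq_bigr => i _; rewrite mulr_sumr.
  rewrite exchange_big; apply: eq_bigr => j _ /=.
  rewrite -adjA mxE mulr_suml; apply: eq_bigr => i _.
  by rewrite !mxE mulrA.
rewrite (bigD1 l) //= big1 => [|j jl]; first by rewrite mxE eqxx mulr1n addr0.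
by rewrite mxE eq_sym (negPf jl) mulr0n mul0r.
Qed.

Lemma det_shift_ideal (A : 'M[P]_n) :
  (forall i, J (mul_shift A i)) -> forall j, J (shift j * \det A).
Proof.
move=> JA j; rewrite mulrC -cramer_shift.
by apply: ideal_sum => i _; apply: idealM.
Qed.

Lemma cofactor_eq_row (A B : 'M[P]_n) i j :
  (forall i', i' != i -> A i' =1 B i') -> cofactor A i j = cofactor B i j.
Proof.
move=> AB; rewrite /cofactor; congr (_ * \det _); apply/matrixP=> i' j'.
by rewrite !mxE AB // eq_sym neq_lift.
Qed.

(** Cramer's rule is applied after replacing row i by the j-th unit vector: the determinant becomes
    the cofactor at (i, j), row i contributes [shift j] times the cofactor at (i, l), and the other
    rows contribute elements of J. *)
Lemma cofactor_koszul (A : 'M[P]_n) i :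
    (forall i', i' != i -> J (mul_shift A i')) ->
  forall j l, J (shift l * cofactor A i j - shift j * cofactor A i l).
Proof.
move=> JA j l.
pose C : 'M[P]_n := \matrix_(i', j') if i' == i then (j' == j)%:R else A i' j'.
have CA i' : i' != i -> C i' =1 A i'.
  by move=> i'i j'; rewrite mxE (negPf i'i).
have cofC l' : cofactor C i l' = cofactor A i l' by apply: cofactor_eq_row.
have Ci F : \sum_j' C i j' * F j' = F j.
  rewrite (bigD1 j) //= big1 ?addr0 => [|j' /negPf j'j].
    by rewrite mxE !eqxx mul1r.
  by rewrite mxE eqxx j'j mul0r.
have detC : \det C = cofactor A i j by rewrite (expand_det_row _ i) Ci cofC.
have := cramer_shift C l; rewrite detC (bigD1 i) //= {1}/mul_shift Ci cofC.
set T := \sum_(_ | _) _; have JT : J T.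
  apply: ideal_sum => i' i'i; apply: (idealM idJ); rewrite /mul_shift.
  by under eq_bigr do rewrite CA //; apply: JA.
move: (cofactor A i j) (cofactor A i l) T JT => cj cl T JT eq_l.
suff -> : shift l * cj - shift j * cl = T by [].
by apply/eqP; rewrite subr_eq (mulrC (shift l)) -eq_l addrC (mulrC cl).
Qed.

(** The difference of the two i-th rows is a syzygy of the t_j - alpha_j, and it is paired with the
    cofactors of row i, to which [koszul_syzygy] applies. *)
Lemma det_row_ideal (A B : 'M[P]_n) i :
    (forall i', i' != i -> A i' =1 B i') ->
    (forall i', i' != i -> J (mul_shift A i')) ->
    mul_shift A i = mul_shift B i ->
  J (\det A - \det B).
Proof.
move=> AB JA eqAB; rewrite (expand_det_row _ i) (expand_det_row B i) -sumrB.
under eq_bigr do rewrite -(@cofactor_eq_row A B i) // -mulrBl.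
apply: koszul_syzygy; first exact: cofactor_koszul.
under eq_bigr do rewrite mulrBl.
by rewrite sumrB; apply/eqP; rewrite subr_eq0; apply/eqP.
Qed.

(** The rows are exchanged one at a time: [C r] takes its first r rows from B. *)
Lemma det_ideal (A B : 'M[P]_n) :
    (forall i, J (mul_shift A i)) -> mul_shift A =1 mul_shift B ->
  J (\det A - \det B).
Proof.
move=> JA AB; pose C r : 'M[P]_n := \matrix_(i, j) if (i < r)%N then B i j else A i j.
have mulC r i : mul_shift (C r) i = mul_shift A i.
  rewrite {1}/mul_shift; under eq_bigr do rewrite mxE.
  by case: ltnP => _ //; rewrite AB.
have <- : C n = B by apply/matrixP=> i j; rewrite mxE ltn_ord.
suff claim r : (r <= n)%N -> J (\det A - \det (C r)) by apply: claim.
elim: r => [_|r IH ltrn].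
  have -> : C 0%N = A by apply/matrixP=> i j; rewrite mxE.
  by rewrite subrr; apply: ideal0 idJ.
rewrite -[\det A](subrK (\det (C r))) -addrA; apply: (idealD idJ).
  exact: IH (ltnW ltrn).
apply: (@det_row_ideal _ _ (Ordinal ltrn)) => [i ir j|i _|].
- by rewrite !mxE ltnS [(i < r)%N]ltn_neqAle (ir : i != r :> nat).
- by rewrite mulC.
- by rewrite !mulC.
Qed.

End Ideal.
End MpolyPoint.

(** * From linear forms on E to elements of the canonical module *)

Section Residue.
Variables (k : fieldType) (E : fieldExtType k) (n : nat) (alpha : 'I_n -> E).
Local Notation P := {mpoly E[n]}.
Local Notation toE := (map_mpoly (in_alg E)).
Local Notation ideal := (pres_ideal alpha).
Implicit Types (phi : 'Hom(E, k^o)) (D : P) (p : {mpoly k[n]}).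

HB.instance Definition _ :=
  GRing.RMorphism.copy (pres_eval alpha) (mmap (in_alg E) alpha).

Lemma pres_evalC c : pres_eval alpha c%:MP = c%:A.
Proof. exact: mmapC. Qed.

Lemma pres_evalZ c p : pres_eval alpha (c *: p) = c *: pres_eval alpha p.
Proof. by rewrite [LHS]mmapZ /= mulr_algl. Qed.

Lemma pres_evalX m : pres_eval alpha 'X_[m] = mmap1 alpha m.
Proof. exact: mmapX. Qed.

Lemma meval_toE p : (toE p).@[alpha] = pres_eval alpha p.
Proof.
move: p; apply: mpoly_ring_ind => [c|j|p q eq_p eq_q|p q eq_p eq_q].
- by rewrite map_mpolyC mevalC pres_evalC.
- by rewrite map_mpolyX mevalXU pres_evalX mmap1U.
- by rewrite rmorphD /= mevalD eq_p eq_q rmorphD.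
- by rewrite rmorphM /= mevalM eq_p eq_q rmorphM.
Qed.

Lemma contract_bound phi D b : (msize D <= b)%N ->
  contract alpha phi D =
    \sum_(m : 'X_{1..n < b}) (phi (mmap1 alpha m) : k)%:A * D@_m.
Proof.
move=> le_Db; rewrite /contract (big_mksub 'X_{1..n < b}) ?msupp_uniq //=.
  by rewrite big_rmcond //= => m /memN_msupp_eq0->; rewrite mulr0.
by move=> m /msize_mdeg_lt /leq_trans; apply.
Qed.

Lemma contract_linear phi : linear (contract alpha phi : P -> E^o).
Proof.
move=> c D D'; pose b := maxn (msize (c *: D + D')) (maxn (msize D) (msize D')).
rewrite !(@contract_bound phi _ b); first last.
- by rewrite /b leq_max leqnn.
- by rewrite /b !leq_max leqnn orbT.
- by rewrite /b !leq_max leqnn !orbT.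
rewrite scaler_sumr -big_split; apply: eq_bigr => m _ /=.
by rewrite mcoeffD mcoeffZ /GRing.scale /=; ring.
Qed.

HB.instance Definition _ phi :=
  GRing.isLinear.Build E P E^o *:%R (contract alpha phi) (contract_linear phi).

Lemma contractX phi m : contract alpha phi 'X_[m] = (phi (mmap1 alpha m) : k)%:A.
Proof. by rewrite /contract msuppX big_seq1 mcoeffX eqxx mulr1. Qed.

Lemma contractZ phi c D : contract alpha phi (c *: D) = c * contract alpha phi D.
Proof. exact: linearZ. Qed.

Lemma contract_toE phi p :
  contract alpha phi (toE p) = (phi (pres_eval alpha p) : k)%:A.
Proof.
rewrite [in LHS](mpolyE p) [in RHS](mpolyE p) !rmorph_sum !linear_sum scaler_suml.
apply: eq_bigr => m _ /=.
rewrite map_mpolyZ contractZ map_mpolyX contractX pres_evalZ pres_evalX.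
by rewrite [in LHS]mulr_algl [in RHS]linearZ /= scalerA.
Qed.

Lemma contract_mulmap phi (psi : 'Hom(E, k^o)) p D :
    (forall y, psi y = phi (pres_eval alpha p * y)) ->
  contract alpha phi (toE p * D) = contract alpha psi D.
Proof.
move=> psiE; rewrite [in LHS](mpolyE D) [in RHS](mpolyE D) mulr_sumr !linear_sum.
apply: eq_bigr => m _ /=; rewrite -scalerAr !contractZ contractX; congr (_ * _).
rewrite psiE -pres_evalX -rmorphM -(map_mpolyX (in_alg E)) -rmorphM /=.
exact: contract_toE.
Qed.

(** The largest ideal of E[t] inside the kernel of the contraction. It contains I E[t], and
    determinants are compared modulo it. *)
Definition contract_ker phi D := forall q, contract alpha phi (q * D) = 0.

Lemma contract_ker_ideal phi : is_ideal (contract_ker phi).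
Proof.
split=> [q|D D' kD kD' q|D D' kD' q]; first by rewrite mulr0 linear0.
  by rewrite mulrDr linearD /= kD kD' addr0.
by rewrite mulrA kD'.
Qed.

Lemma contract_ker_pres phi (g : ideal) : contract_ker phi (toE (val g)).
Proof.
move=> q; pose zero : 'Hom(E, k^o) := 0.
rewrite mulrC (@contract_mulmap phi zero) => [|y].
  rewrite /contract big1 // => m _.
  by rewrite /zero lfunE /= scale0r mul0r.
by rewrite (eqP (valP g)) mul0r linear0 lfunE.
Qed.

Definition expresses (g : 'I_n -> ideal) (A : 'M[P]_n) :=
  forall i, toE (val (g i)) = mul_shift alpha A i.

Lemma expresses_ker phi g A :
  expresses g A -> forall i, contract_ker phi (mul_shift alpha A i).
Proof. by move=> gA i; rewrite -gA; apply: contract_ker_pres. Qed.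

(* (t_j - alpha_j) det A lies in I by Cramer, so that the two E-structures of   *)
(* E (x)_k E agree on the class of det A.                                       *)
Lemma contract_det_semilinear phi p g A : expresses g A ->
  contract alpha phi (toE p * \det A) =
  pres_eval alpha p * contract alpha phi (\det A).
Proof.
move=> gA; have idJ := contract_ker_ideal phi.
have [s [_ ->]] := psub_decomp alpha xpredT (toE p).
rewrite psubT meval_toE mulrDl mul_mpolyC mulr_suml linearD /= contractZ.
rewrite [X in _ + X](_ : _ = 0) ?addr0 //.
rewrite linear_sum; apply: big1 => j _; rewrite -mulrA /=.
exact: (det_shift_ideal idJ (expresses_ker phi gA)).
Qed.

Lemma contract_det_unique phi g A B : expresses g A -> expresses g B ->
  contract alpha phi (\det A) = contract alpha phi (\det B).
Proof.
move=> gA gB; apply/eqP; rewrite -subr_eq0 -linearB -[_ - _]mul1r; apply/eqP.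
apply: (det_ideal (contract_ker_ideal phi) (expresses_ker phi gA)) => i.
by rewrite -gA gB.
Qed.

Lemma pres_row_exists (g : ideal) :
  exists s : 'I_n -> P, toE (val g) = \sum_j s j * shift alpha j.
Proof.
have [s [_ eq_g]] := psub_decomp alpha xpredT (toE (val g)); exists s.
by rewrite [LHS]eq_g psubT meval_toE (eqP (valP g)) mpolyC0 add0r.
Qed.

Definition pres_row (g : ideal) : 'I_n -> P := projT1 (cid (pres_row_exists g)).
Definition pres_mx (g : 'I_n -> ideal) : 'M[P]_n := \matrix_(i, j) pres_row (g i) j.

Lemma pres_mxP g : expresses g (pres_mx g).
Proof.
move=> i; rewrite /mul_shift; under eq_bigr do rewrite mxE.
by rewrite /pres_row; case: (cid _).
Qed.

Definition residue phi (g : 'I_n -> ideal) : E^o := contract alpha phi (\det (pres_mx g)).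

Lemma residueE phi g A : expresses g A -> residue phi g = contract alpha phi (\det A).
Proof. exact/contract_det_unique/pres_mxP. Qed.

(** Additivity and alternation come from the determinant. A factor p in I leaves the contraction as
    its value in E by [contract_det_semilinear]. *)
Lemma residue_conormal phi : residue phi \in conormal_pred (alpha := alpha).
Proof.
apply/asboolP; split=> [i g h r p eq_gr eq_r|i j g ij gij]; last first.
  rewrite /residue (determinant_alternate ij) ?linear0 // => l.
  by rewrite !mxE gij.
(* Any matrix expressing a family may be used, so the three matrices are chosen with equal rows
   outside i and with row i of R the required combination. *)
pose R : 'M[P]_n := \matrix_(i', j)
  if i' == i then toE p * pres_mx g i j + pres_mx h i j else pres_mx r i' j.
pose G : 'M[P]_n := \matrix_(i', j) if i' == i then pres_mx g i j else pres_mx r i' j.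
pose H : 'M[P]_n := \matrix_(i', j) if i' == i then pres_mx h i j else pres_mx r i' j.
have [gG hH rR] : [/\ expresses g G, expresses h H & expresses r R].
  split=> i'; rewrite /mul_shift; under eq_bigr do rewrite mxE;
    have [->|i'i] := eqVneq i' i.
  - exact: pres_mxP.
  - by have [-> _] := eq_gr _ i'i; apply: pres_mxP.
  - exact: pres_mxP.
  - by have [_ ->] := eq_gr _ i'i; apply: pres_mxP.
  - rewrite eq_r rmorphD rmorphM /= !pres_mxP mulr_sumr -big_split.
    by apply: eq_bigr => j _ /=; ring.
  - exact: pres_mxP.
rewrite (residueE _ rR) (residueE _ gG) (residueE _ hH).
have -> : \det R = toE p * \det G + 1 * \det H.
  apply: (determinant_multilinear (i0 := i)).
  - by rewrite [X in _ + X]scale1r; apply/rowP=> j; rewrite !mxE eqxx.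
  - by apply/matrixP=> i' j; rewrite !mxE eq_sym (negPf (neq_lift _ _)).
  - by apply/matrixP=> i' j; rewrite !mxE eq_sym (negPf (neq_lift _ _)).
by rewrite mul1r linearD /= (contract_det_semilinear _ _ gG).
Qed.

Definition residue_omega phi : omega alpha := Omega (residue_conormal phi).

Lemma purity_residue phi : purity phi (residue_omega phi).
Proof. by move=> g A gA; apply: residueE. Qed.

Lemma purity_scale phi (psi : 'Hom(E, k^o)) p (eta : omega alpha) :
    (forall y, psi y = phi (pres_eval alpha p * y)) -> purity phi eta ->
  purity psi (pres_eval alpha p *: eta).
Proof.
move=> psiE pur g A gA; rewrite -(contract_mulmap _ psiE).
rewrite (contract_det_semilinear _ _ (gA : expresses g A)) -(pur g A gA).
by [].
Qed.

End Residue.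

(** * An alternating form on I is determined by its value on generators *)

Section ConormalUnique.
Variables (k : fieldType) (E : fieldExtType k) (n : nat) (alpha : 'I_n -> E).
Local Notation ideal := (pres_ideal alpha).
Variable eta : ('I_n -> ideal) -> E^o.
Hypothesis eta_form : conormal_form eta.
Implicit Types (g : 'I_n -> ideal) (x y : ideal).

Definition mk_pres (p : {mpoly k[n]}) (p0 : pres_eval alpha p == 0) : ideal :=
  exist (fun p => pres_eval alpha p == 0) p p0.

Definition fupd g (i : 'I_n) x : 'I_n -> ideal := fun j => if j == i then x else g j.

Lemma fupd_id g i : fupd g i (g i) = g.
Proof. by apply/funext=> j; rewrite /fupd; case: eqP => [->|]. Qed.

Lemma conormal_fupd g i p x y z : val z = p * val x + val y ->
  eta (fupd g i z) = pres_eval alpha p *: eta (fupd g i x) + eta (fupd g i y).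
Proof.
move=> eq_z; apply: (conormal_linear eta_form (i := i)).
  by move=> j /negPf ji; rewrite /fupd ji.
by rewrite /fupd !eqxx.
Qed.

Lemma conormal_comb g i (h : 'I_n -> ideal) (c : 'I_n -> {mpoly k[n]}) :
    val (g i) = \sum_l c l * val (h l) ->
    (forall l, eta (fupd g i (h l)) = 0) ->
  eta g = 0.
Proof.
move=> eq_gi eta0; rewrite -(fupd_id g i); move: (g i) eq_gi.
elim: (index_enum _) => [|l s IH] z; rewrite ?big_nil ?big_cons => eq_z.
  (* For a zero entry, 0 = 1 * 0 + 0 gives eta = eta + eta. *)
  have := @conormal_fupd g i 1 z z z; rewrite eq_z mulr0 addr0 => /(_ erefl).
  rewrite rmorph1 scale1r => /eqP.
  by rewrite -subr_eq0 opprD addNKr oppr_eq0 => /eqP.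
have comb0 : pres_eval alpha (\sum_(l' <- s) c l' * val (h l')) == 0.
  rewrite rmorph_sum big1 // => l' _.
  by rewrite rmorphM /= (eqP (valP (h l'))) mulr0.
rewrite (@conormal_fupd g i (c l) (h l) (mk_pres comb0)) //.
by rewrite eta0 scaler0 add0r IH.
Qed.

(** Polarisation: eta vanishes when the entries i and j both equal g_i + g_j, so swapping them
    changes its sign. *)
Lemma conormal_swap g i j : eta g = 0 -> eta (g \o tperm i j) = 0.
Proof.
have [->|ij] := eqVneq i j.
  by rewrite tperm1 => <-; congr eta; apply/funext=> l /=; rewrite perm1.
move=> g0; pose pair x y := fupd (fupd g i x) j y.
have pairC x y : pair x y = fupd (fupd g j y) i x.
  apply/funext=> l; rewrite /pair /fupd.
  by have [->|//] := eqVneq l j; rewrite eq_sym (negPf ij).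
have pair0 x : eta (pair x x) = 0.
  apply: (conormal_alternate eta_form ij).
  by rewrite /pair /fupd !eqxx (negPf ij).
have add0 : pres_eval alpha (val (g i) + val (g j)) == 0.
  by rewrite rmorphD /= !(eqP (valP (g _))) addr0.
pose s : ideal := mk_pres add0.
have pairDr x : eta (pair x s) = eta (pair x (g i)) + eta (pair x (g j)).
  rewrite /pair (@conormal_fupd _ j 1 (g i) (g j)) ?mul1r //.
  by rewrite rmorph1 scale1r.
have pairDl y : eta (pair s y) = eta (pair (g i) y) + eta (pair (g j) y).
  rewrite !pairC (@conormal_fupd _ i 1 (g i) (g j)) ?mul1r //.
  by rewrite rmorph1 scale1r.
have pairE : pair (g i) (g j) = g by rewrite /pair !fupd_id.
have := pair0 s; rewrite pairDr !pairDl !pair0 pairE g0 !addr0 add0r.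
move=> <-; congr eta; apply/funext=> l /=; rewrite /pair /fupd.
by case: tpermP => [->|->|/eqP/negPf-> /eqP/negPf->]; rewrite ?eqxx // (negPf ij).
Qed.

Lemma conormal_perm g (s : 'S_n) : eta g = 0 -> eta (g \o s) = 0.
Proof.
move=> g0; have [ts -> _] := prod_tpermP s.
elim: ts => [|t ts IH].
  by rewrite big_nil -[RHS]g0; congr eta; apply/funext=> l /=; rewrite perm1.
rewrite big_cons; move: (\prod_(_ <- _) _)%g IH => u IH.
rewrite -[RHS](conormal_swap t.1 t.2 IH); congr eta.
by apply/funext=> l /=; rewrite permM.
Qed.

(** The entries of g are expanded over f one by one, r counting those still to expand. There remain
    families f \o s, which are permutations of f or have a repeated entry. *)
Lemma conormal_eq0 (f : 'I_n -> ideal) :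
    (forall x, exists c : 'I_n -> {mpoly k[n]}, val x = \sum_l c l * val (f l)) ->
    eta f = 0 ->
  forall g, eta g = 0.
Proof.
move=> gen_f f0.
suff claim r : (r <= n)%N -> forall g,
    (exists s : 'I_n -> 'I_n, forall i : 'I_n, (r <= i)%N -> g i = f (s i)) ->
    eta g = 0.
  move=> g; apply: (claim n) => //; exists id => i.
  by rewrite leqNgt ltn_ord.
elim: r => [_ g [s eq_g]|r IH ltrn g [s eq_g]].
  have -> : g = f \o s by apply/funext=> i; apply: eq_g.
  have [inj_s|/injectivePn[i [j ij sij]]] := boolP (injectiveb s).
    rewrite -[RHS](conormal_perm (perm (injectiveP _ inj_s)) f0); congr eta.
    by apply/funext=> i; rewrite /= permE.
  by apply: (conormal_alternate eta_form ij); rewrite /= sij.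
pose i := Ordinal ltrn; have [c eq_c] := gen_f (g i).
apply: (conormal_comb eq_c) => l; apply: (IH (ltnW ltrn)).
exists (fun j => if j == i then l else s j) => j lerj; rewrite /fupd.
have [//|ji] := eqVneq j i; apply: eq_g.
by rewrite ltn_neqAle lerj andbT eq_sym.
Qed.

End ConormalUnique.

(** * The triangular family f generates I *)

Lemma eq_adjoin (k : fieldType) (E : fieldExtType k) (U : {vspace E}) (s t : seq E) :
  s =i t -> <<U & s>>%VS = <<U & t>>%VS.
Proof.
by move=> st; apply/eqP; rewrite eqEsubv !adjoin_seqSr // => x; rewrite st.
Qed.

Section Presentation.
Variables (k : fieldType) (E : fieldExtType k) (n : nat) (alpha : 'I_n -> E).
Local Notation ideal := (pres_ideal alpha).
Local Notation Pk := {mpoly k[n]}.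
Local Notation PE := {mpoly E[n]}.
Local Notation toE := (map_mpoly (in_alg E)).

(* The generators indexed by nat, with 0 as junk value.                         *)
Definition nat_gen (j : nat) : E := oapp alpha 0 (insub j).
Local Notation K := (tower nat_gen).

Lemma nat_gen_ord (i : 'I_n) : nat_gen i = alpha i.
Proof. by rewrite /nat_gen valK. Qed.

Lemma tower_adjoin r : (r <= n)%N ->
  <<1 & [seq alpha j | j : 'I_n <- enum 'I_n & (j < r)%N]>>%VS = K r.
Proof.
elim: r => [_|r IH ltrn].
  rewrite (eq_filter (a2 := pred0)) // filter_pred0 adjoin_nil.
  exact: (subfield_closed 1%AS).
rewrite -[RHS]/(<<K r; nat_gen r>>)%VS -(IH (ltnW ltrn)) -adjoin_rcons.
rewrite -[r in nat_gen r]/(val (Ordinal ltrn)) nat_gen_ord -map_rcons.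
apply/eq_adjoin/eq_mem_map => j.
have memE (Q : pred _) : (j \in [seq j0 <- enum 'I_n | Q j0]) = Q j.
  by rewrite mem_filter mem_enum andbT.
rewrite mem_rcons inE !memE ltnS leq_eqVlt.
by [].
Qed.

(** Membership in k[t_0, ..., t_(r-1)], encoded as invariance under setting the other variables to
    0, so that closure under ring operations comes from [psub] being a morphism. *)
Definition in_vars r (p : Pk) := psub (fun=> 0) (fun j : 'I_n => r <= j)%N p = p.

Lemma in_varsM r p q : in_vars r p -> in_vars r q -> in_vars r (p * q).
Proof. by rewrite /in_vars rmorphM /= => -> ->. Qed.

Lemma in_varsD r p q : in_vars r p -> in_vars r q -> in_vars r (p + q).
Proof. by rewrite /in_vars rmorphD /= => -> ->. Qed.

Lemma in_vars0 r : in_vars r 0.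
Proof. by rewrite /in_vars rmorph0. Qed.

Lemma in_varsC r c : in_vars r c%:MP.
Proof. exact: psubC. Qed.

Lemma in_varsX r (m : 'X_{1..n}) : (forall j : 'I_n, (r <= j)%N -> m j = 0%N) -> in_vars r 'X_[m].
Proof.
move=> m0; rewrite /in_vars {1}/psub mmapX mpolyXE_id; apply: eq_bigr => j _.
by rewrite /psub_var; case: leqP => // /m0->; rewrite !expr0.
Qed.

Lemma in_vars_full p : in_vars n p.
Proof.
move: p; apply: mpoly_ring_ind => [c|j|p q|p q].
- exact: in_varsC.
- by apply: in_varsX => j'; rewrite leqNgt ltn_ord.
- exact: in_varsD.
- exact: in_varsM.
Qed.

Lemma in_vars_eval r p : in_vars r p -> pres_eval alpha p \in K r.
Proof.
move=> <-; move: p; apply: mpoly_ring_ind => [c|j|p q|p q].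
- rewrite psubC pres_evalC.
  exact: (rpredZ c (mem1v (K r))).
- rewrite psubX /psub_var; case: leqP => [_|ltjr].
    by rewrite mpolyC0 rmorph0 mem0v.
  rewrite pres_evalX mmap1U -nat_gen_ord.
  elim: r ltjr => // r IH; rewrite ltnS leq_eqVlt => /orP[/eqP->|/IH].
    exact: tower_mem.
  exact/subvP/towerS.
- by rewrite !rmorphD; apply: rpredD.
- by rewrite !rmorphM; apply: rpredM.
Qed.

Lemma pres_eval_surj r y : y \in K r -> exists p, pres_eval alpha p = y.
Proof.
elim: r y => [|r IH] y.
  by move=> /vlineP[c ->]; exists c%:MP; rewrite pres_evalC.
move=> /Fadjoin_polyP[q /polyOverP Kq ->]; rewrite horner_coef.
elim/big_ind: _ => [|u v [p <-] [p' <-]|s _].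
- by exists 0; rewrite rmorph0.
- by exists (p + p'); rewrite rmorphD.
have [p <-] := IH _ (Kq s); rewrite /nat_gen; case: insub => [i|] /=.
  exists (p * 'X_i ^+ s); rewrite rmorphM rmorphXn.
  by rewrite /= pres_evalX mmap1U.
exists (p * (0 : Pk) ^+ s); rewrite rmorphM rmorphXn.
by rewrite /= rmorph0.
Qed.

Variable f : 'I_n -> ideal.
Hypothesis pres_f : presentation f.

Local Notation deg i := (adjoin_degree (K i) (nat_gen i)).

Definition spec_var (i : 'I_n) (j : 'I_n) : {poly E} :=
  if j == i then 'X else (alpha j)%:P.

Lemma mmap1_spec i m :
  mmap1 (spec_var i) m = (\prod_(j < n | j != i) alpha j ^+ m j)%:P * 'X^(m i).
Proof.
rewrite /mmap1 (bigD1 i) //= /spec_var eqxx mulrC rmorph_prod /=; congr (_ * _).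
by apply: eq_bigr => j /negPf->; rewrite rmorphXn.
Qed.

Lemma minPoly_spec (i : 'I_n) :
  mmap (fun c : k => (c%:A : E)%:P) (spec_var i) (val (f i)) =
  minPoly (K i) (nat_gen i).
Proof.
have [_ _ ->] := pres_f i.
by rewrite (tower_adjoin (ltnW (ltn_ord i))) nat_gen_ord.
Qed.

(** Specialising f_i to the minimal polynomial of alpha_i keeps t_i^e as its leading term, so the
    exponent e of the presentation is the degree of that polynomial. *)
Lemma presentation_lead (i : 'I_n) m :
  m \in msupp (val (f i) - 'X_i ^+ deg i) -> (m i < deg i)%N.
Proof.
have [_ [e lt_e] _] := pres_f i; suff -> : deg i = e by apply: lt_e.
have := minPoly_spec i; pose phi : {rmorphism k -> {poly E}} := polyC \o in_alg E.
rewrite -[LHS]/(mmap phi (spec_var i) (val (f i))).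
rewrite -[val (f i)](subrK ('X_i ^+ e)) rmorphD rmorphXn /= mmapX mmap1U.
rewrite {2}/spec_var eqxx => /(congr1 (size \o val))/=.
rewrite size_minPoly addrC size_polyDl ?size_polyXn => [[]//|].
rewrite ltnS /mmap; apply: (leq_trans (size_sum _ _ _)).
rewrite big_tnth; apply/bigmax_leqP=> t _.
have := mem_tnth t (in_tuple (msupp (val (f i) - 'X_i ^+ e))).
move: (tnth _ t) => {}m /lt_e lt_m.
rewrite mmap1_spec mulrA -polyCM mul_polyC.
by apply: (leq_trans (size_scale_leq _ _)); rewrite size_polyXn.
Qed.

Definition pres_gen (p : Pk) : Prop :=
  exists c : 'I_n -> Pk, p = \sum_l c l * val (f l).

Lemma pres_gen_ideal : is_ideal pres_gen.
Proof.
split=> [|p q [c ->] [d ->]|p q [c ->]].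
- by exists (fun=> 0); rewrite big1 // => l _; rewrite mul0r.
- exists (fun l => c l + d l); rewrite -big_split; apply: eq_bigr => l _.
  by rewrite mulrDl.
- exists (fun l => p * c l); rewrite mulr_sumr; apply: eq_bigr => l _.
  by rewrite mulrA.
Qed.

Lemma pres_gen_f i : pres_gen (val (f i)).
Proof.
exists (fun l => (l == i)%:R); rewrite (bigD1 i) //= eqxx mul1r big1 ?addr0 //.
by move=> l /negPf->; rewrite mul0r.
Qed.

Section Reduction.
Variable i : 'I_n.

(** Remainders of division by f_i, taken modulo all the f_l. *)
Definition reducible (p : Pk) : Prop := exists c : nat -> Pk,
  (forall s, in_vars i (c s)) /\ pres_gen (p - \sum_(s < deg i) c s * 'X_i ^+ s).

Let idJ := pres_gen_ideal.

Lemma reducible_gen p : pres_gen p -> reducible p.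
Proof.
move=> Jp; exists (fun=> 0); split=> [s|]; first exact: in_vars0.
by rewrite big1 ?subr0 // => s _; rewrite mul0r.
Qed.

Lemma reducibleD p q : reducible p -> reducible q -> reducible (p + q).
Proof.
move=> [c [Kc Jp]] [d [Kd Jq]]; exists (fun s => c s + d s); split=> [s|].
  exact: in_varsD.
under eq_bigr do rewrite mulrDl.
by rewrite big_split opprD addrACA; apply: (idealD idJ).
Qed.

Lemma reducible_sum I r (Q : pred I) F :
  (forall j, Q j -> reducible (F j)) -> reducible (\sum_(j <- r | Q j) F j).
Proof.
move=> redF; apply: big_ind => //; last exact: reducibleD.
exact/reducible_gen/(ideal0 idJ).
Qed.

Lemma reducibleM_vars u p : in_vars i u -> reducible p -> reducible (u * p).
Proof.
move=> Ku [c [Kc Jp]]; exists (fun s => u * c s); split=> [s|].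
  exact: in_varsM.
under eq_bigr do rewrite -mulrA.
by rewrite -mulr_sumr -mulrBr; apply: (idealM idJ).
Qed.

Lemma reducible_monom u s : in_vars i u -> (s < deg i)%N -> reducible (u * 'X_i ^+ s).
Proof.
move=> Ku lt_s; exists (fun t => if t == s then u else 0); split=> [t|].
  by case: ifP => // _; apply: in_vars0.
rewrite (bigD1 (Ordinal lt_s)) //= eqxx big1 => [|t /negPf].
  by rewrite addr0 subrr; apply: (ideal0 idJ).
by rewrite -val_eqE /= => ->; rewrite mul0r.
Qed.

Lemma reducible_lead : reducible ('X_i ^+ deg i).
Proof.
have [vars_f _ _] := pres_f i.
rewrite -['X_i ^+ _](subrK (val (f i))); apply: reducibleD; last first.
  exact/reducible_gen/pres_gen_f.
rewrite -opprB -mulN1r (_ : -1 = (-1)%:MP) ?mpolyCN ?mpolyC1 //.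
apply: reducibleM_vars; first by rewrite -mpolyC1 -mpolyCN; apply: in_varsC.
set h := _ - _; rewrite (mpolyE h) big_seq; apply: reducible_sum => m supp_m.
have lt_m : (m i < deg i)%N by apply: presentation_lead.
have m0 (j : 'I_n) : (i < j)%N -> m j = 0%N.
  move=> ij; have := msuppB_le supp_m; rewrite mem_cat => /orP[|].
    exact: vars_f.
  rewrite mpolyXn => /mem_msuppXP <-; rewrite mulmnE mnm1E.
  by rewrite -val_eqE /= ltn_eqF.
have -> : 'X_[m] = 'X_[m - U_(i) *+ m i] * 'X_i ^+ m i :> Pk.
  rewrite mpolyXn -mpolyXD submK //; apply/mnm_lepP => j.
  by rewrite mulmnE mnm1E; case: eqP => [->|_]; rewrite ?mul1n ?mul0n.
rewrite scalerAl; apply: reducible_monom => //.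
rewrite -mul_mpolyC; apply: in_varsM; first exact: in_varsC.
apply: in_varsX => j leij; rewrite mnmBE mulmnE mnm1E.
case: (ltngtP i j) leij => // [ij _|/val_inj<- _]; first by rewrite m0.
by rewrite eqxx mul1n subnn.
Qed.

Lemma reducibleMX p : reducible p -> reducible ('X_i * p).
Proof.
move=> [c [Kc Jp]]; rewrite -[p](subrK (\sum_(s < deg i) c s * 'X_i ^+ s)).
rewrite mulrDr; apply: reducibleD; first exact/reducible_gen/(idealM idJ).
rewrite mulr_sumr; apply: reducible_sum => s _; rewrite mulrCA -exprS.
have := ltn_ord s; rewrite leq_eqVlt => /orP[/eqP->|].
  exact/reducibleM_vars/reducible_lead.
exact: reducible_monom.
Qed.

Lemma reducibleM p q : reducible p -> reducible q -> reducible (p * q).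
Proof.
move=> [c [Kc Jp]] red_q; rewrite -[p](subrK (\sum_(s < deg i) c s * 'X_i ^+ s)).
rewrite mulrDl; apply: reducibleD.
  by apply/reducible_gen; rewrite mulrC; apply: (idealM idJ).
rewrite mulr_suml; apply: reducible_sum => s _; rewrite -mulrA.
apply: reducibleM_vars => //; elim: (s : nat) => [|t IH]; first by rewrite mul1r.
by rewrite exprS -mulrA; apply: reducibleMX.
Qed.

Lemma reducible_vars_lt p : in_vars i p -> reducible p.
Proof. by move=> Kp; rewrite -[p]mulr1 -(expr0 'X_i); apply: reducible_monom. Qed.

Lemma reducible_vars p : in_vars i.+1 p -> reducible p.
Proof.
move=> <-; move: p; apply: mpoly_ring_ind => [c|j|p q|p q].
- by rewrite psubC; apply/reducible_vars_lt/in_varsC.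
- rewrite psubX /psub_var; case: ltngtP => [_|ltji|/val_inj<-].
  + by apply/reducible_vars_lt; rewrite mpolyC0; apply: in_vars0.
  + apply/reducible_vars_lt/in_varsX => j' leij'; rewrite mnm1E.
    by rewrite -val_eqE /= ltn_eqF // (leq_trans ltji).
  + by rewrite -[X in reducible X]mulr1; apply/reducibleMX/reducible_vars_lt/in_varsC.
- by rewrite rmorphD; apply: reducibleD.
- by rewrite rmorphM; apply: reducibleM.
Qed.

End Reduction.

(** After division by the polynomial monic in the last variable, the remainder has coefficients
    whose values at alpha form a polynomial of degree below that of the minimal polynomial and with
    the generator as root. These values are therefore 0, and the induction applies to each
    coefficient. *)
Lemma pres_gen_vars r p : (r <= n)%N ->
  in_vars r p -> pres_eval alpha p = 0 -> pres_gen p.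
Proof.
elim: r p => [|r IH] p ltrn Kp p0.
  move: p0; rewrite -Kp (_ : (fun j : 'I_n => 0 <= j)%N = xpredT) //.
  rewrite psubT pres_evalC => /eqP.
  rewrite scaler_eq0 oner_eq0 orbF => /eqP->.
  by rewrite mpolyC0; apply: ideal0 pres_gen_ideal.
pose i := Ordinal ltrn.
have [c [Kc Jp]] := @reducible_vars i _ Kp.
rewrite -[p](subrK (\sum_(s < deg i) c s * 'X_i ^+ s)).
apply: (idealD pres_gen_ideal) => //.
pose q := \poly_(s < deg i) pres_eval alpha (c s).
have Kq : q \is a polyOver (K i).
  by apply/polyOverP=> s; rewrite coef_poly; case: ifP => _; rewrite ?mem0v ?in_vars_eval.
have q0 : q = 0.
  apply/eqP; rewrite -(root_small_adjoin_poly Kq (size_poly _ _)) /root horner_poly.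
  have [d eq_d] := Jp; move/(congr1 (pres_eval alpha)): eq_d.
  rewrite rmorphB /= p0 sub0r.
  rewrite [in RHS]rmorph_sum [RHS]big1 => [|l _]; last first.
    by rewrite rmorphM /= (eqP (valP (f l))) mulr0.
  move/eqP; rewrite oppr_eq0 rmorph_sum => /eqP sum0.
  apply/eqP; rewrite -[RHS]sum0; apply: eq_bigr => s _.
  rewrite [RHS]rmorphM /= rmorphXn /= pres_evalX mmap1U.
  by rewrite -nat_gen_ord.
apply: (ideal_sum pres_gen_ideal) => s _; rewrite mulrC.
apply: (idealM pres_gen_ideal); apply: IH (ltnW ltrn) (Kc s) _.
by have := congr1 (fun r : {poly E} => r`_s) q0; rewrite coef0 coef_poly ltn_ord.
Qed.

Lemma pres_ideal_gen (g : ideal) : pres_gen (val g).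
Proof. exact: pres_gen_vars (leqnn n) (in_vars_full _) (eqP (valP g)). Qed.

End Presentation.

(** * Expansion of the determinant attached to the presentation *)

Section EulerDet.
Variables (k : fieldType) (E : fieldExtType k) (n : nat) (alpha : 'I_n -> E).
Variable f : 'I_n -> pres_ideal alpha.
Hypothesis pres_f : presentation f.
Local Notation PE := {mpoly E[n]}.
Local Notation toE := (map_mpoly (in_alg E)).
Local Notation K := (tower (nat_gen alpha)).
Local Notation quo i := (min_quo (K i) (nat_gen alpha i)).
Local Notation deg i := (adjoin_degree (K i) (nat_gen alpha i)).

Definition poly_at (i : 'I_n) (q : {poly E}) : PE :=
  (map_poly (@mpolyC n E) q).['X_i].
HB.instance Definition _ i := GRing.RMorphism.copy (poly_at i)
  (horner_eval ('X_i : PE) \o map_poly (@mpolyC n E)).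

Lemma poly_atC i c : poly_at i c%:P = c%:MP.
Proof. by rewrite /poly_at map_polyC hornerC. Qed.

Lemma poly_atX i : poly_at i 'X = 'X_i.
Proof. by rewrite /poly_at map_polyX hornerX. Qed.

Lemma poly_at_wide i (q : {poly E}) e : (size q <= e)%N ->
  poly_at i q = \sum_(s < e) q`_s *: 'X_i ^+ s.
Proof.
move=> szq; rewrite /poly_at (horner_coef_wide (n := e)); last first.
  exact: leq_trans (size_poly _ _) szq.
by apply: eq_bigr => s _; rewrite coef_map /= mul_mpolyC.
Qed.

(** No variable beyond t_i occurs in f_i, so substituting for the earlier ones alone already yields
    the specialisation in [presentation]. *)
Lemma psub_presentation (i : 'I_n) :
  psub alpha (fun j : 'I_n => j < i)%N (toE (val (f i))) =
  poly_at i (minPoly (K i) (nat_gen alpha i)).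
Proof.
have [vars_f _ _] := pres_f i; rewrite -(minPoly_spec pres_f).
move: (val (f i)) vars_f => p vars_p; rewrite [in RHS]/mmap [X in toE X]mpolyE.
rewrite [X in psub _ _ X]rmorph_sum [LHS]rmorph_sum [RHS]rmorph_sum !big_seq.
apply: eq_bigr => m supp_m /=.
rewrite map_mpolyZ map_mpolyX -mul_mpolyC !rmorphM /= psubC poly_atC; congr (_ * _).
rewrite mmap1_spec rmorphM rmorphXn /= poly_atC poly_atX [LHS]mmapX.
rewrite /mmap1 (bigD1 i) //= /psub_var ltnn mulrC rmorph_prod; congr (_ * _).
apply: eq_bigr => j ji; rewrite rmorphXn /=.
case: (ltngtP j i) => [//|ij|/val_inj eq_ij]; last by rewrite eq_ij eqxx in ji.
by rewrite (vars_p j m ij supp_m) !expr0.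
Qed.

(* Modulo t_j - alpha_j for j < i, the polynomial f_i becomes minPoly(t_i), so   *)
(* that the f_i are expressed by a triangular matrix.                           *)
Lemma presentation_det : exists A : 'M[PE]_n,
  expresses f A /\ \det A = \prod_i poly_at i (quo i).
Proof.
have decomp (i : 'I_n) := psub_decomp alpha (fun j : 'I_n => j < i)%N (toE (val (f i))).
pose s i := projT1 (cid (decomp i)).
have [s0 eq_s] : (forall i j : 'I_n, (i <= j)%N -> s i j = 0) /\
    forall i, toE (val (f i)) =
      poly_at i (minPoly (K i) (nat_gen alpha i)) + \sum_j s i j * shift alpha j.
  split=> i; rewrite /s; case: (cid _) => t [t0 eq_t] /=.
    by move=> j leij; apply: t0; rewrite -leqNgt.
  by rewrite -psub_presentation.
pose A : 'M[PE]_n := \matrix_(i, j) (s i j + (j == i)%:R * poly_at i (quo i)).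
exists A; split.
  move=> i; rewrite eq_s -min_quoK rmorphM rmorphB /= poly_atX poly_atC.
  rewrite [X in X%:MP]nat_gen_ord -/(shift alpha i) /mul_shift addrC.
  under [RHS]eq_bigr do rewrite mxE mulrDl.
  rewrite big_split; congr (_ + _).
  rewrite (bigD1 i) //= eqxx mul1r big1 ?addr0 // => j /negPf->.
  by rewrite !mul0r.
rewrite det_trig.
  by apply: eq_bigr => i _; rewrite mxE s0 // add0r eqxx mul1r.
apply/is_trig_mxP=> i j ij; rewrite mxE s0 1?ltnW // -val_eqE /=.
by rewrite gtn_eqF // mul0r addr0.
Qed.

Lemma sum_divmod (V : nmodType) (D d : nat) (F : nat -> nat -> V) : (0 < D)%N ->
  \sum_(0 <= t < d * D) F (t %% D)%N (t %/ D)%N =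
  \sum_(0 <= s < d) \sum_(0 <= i < D) F i s.
Proof.
move=> D0; elim: d => [|d IH]; first by rewrite mul0n !big_geq.
rewrite big_nat_recr //= -IH mulSn addnC.
rewrite (big_cat_nat _ (n := (d * D)%N)) ?leq_addr //=; congr (_ + _).
rewrite -{1}[(d * D)%N]add0n big_addn addKn !big_nat; apply: eq_bigr => i /= iD.
by rewrite addnC modnMDl modn_small // divnMDl // divn_small // addn0.
Qed.

(** The exponents of [M t] are the mixed radix digits of t, in the indexing shared by [tower_basis]
    and [tower_dual]; a new factor adds a top digit. *)
Lemma prod_min_quo r : (r <= n)%N -> exists M : nat -> 'X_{1..n},
  (forall t, mmap1 alpha (M t) = tower_basis (nat_gen alpha) r t) /\
  \prod_(i < n | (i < r)%N) poly_at i (quo i) =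
  \sum_(0 <= t < \dim (K r)) tower_dual (nat_gen alpha) r t *: 'X_[M t].
Proof.
elim: r => [_|r IH ltrn].
  exists (fun=> 0%MM); split=> [t|]; first exact: mmap11.
  by rewrite big_pred0 // dimv1 big_nat1 scale1r mpolyX0.
have [M [evM prodM]] := IH (ltnW ltrn); pose i := Ordinal ltrn.
set D := \dim (K r).
exists (fun t => M (t %% D)%N + U_(i) *+ (t %/ D)%N)%MM; split=> [t|].
  rewrite -pres_evalX mpolyXD -mpolyXn rmorphM rmorphXn /= !pres_evalX mmap1U.
  by rewrite evM -nat_gen_ord.
rewrite (bigD1 i) //= (eq_bigl (fun j : 'I_n => (j < r)%N)) => [|j]; last first.
  by rewrite ltnS [(j < r)%N]ltn_neqAle andbC.
rewrite prodM dim_towerS -/D.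
rewrite (sum_divmod _ (fun t s => (tower_dual (nat_gen alpha) r t * (quo i)`_s) *:
  'X_[(M t + U_(i) *+ s)%MM])) ?dim_tower_gt0 //.
rewrite (poly_at_wide i (e := deg i)) ?size_min_quo // mulr_suml [RHS]big_mkord.
apply: eq_bigr => s _; rewrite mulr_sumr; apply: eq_bigr => t _.
by rewrite mpolyXD -mpolyXn -scalerAl -scalerAr scalerA mulrC [X in _ *: X]mulrC.
Qed.

Lemma contract_presentation phi A : expresses f A ->
  contract alpha phi (\det A) =
  \sum_(0 <= t < \dim (K n))
    (phi (tower_basis (nat_gen alpha) n t) : k)%:A * tower_dual (nat_gen alpha) n t.
Proof.
move=> fA; have [B [fB detB]] := presentation_det.
rewrite (contract_det_unique _ fA fB) detB.
have [M [evM prodM]] := prod_min_quo (leqnn n).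
rewrite (eq_bigl (fun i : 'I_n => (i < n)%N)) => [|i]; last by rewrite ltn_ord.
rewrite prodM raddf_sum; apply: eq_bigr => t _ /=.
by rewrite contractZ contractX evM mulrC.
Qed.

End EulerDet.

(** * The trace on the canonical module and the transfer *)

Section Trace.
Variables (k : fieldType) (E : fieldExtType k) (n : nat) (alpha : 'I_n -> E).
Variable f : 'I_n -> pres_ideal alpha.
Hypothesis pres_f : presentation f.
Hypothesis gen_alpha : <<1 & [seq alpha i | i : 'I_n]>>%VS = fullv.
Local Notation a := (nat_gen alpha).
Local Notation K := (tower a).

Lemma tower_full : K n = fullv :> {vspace E}.
Proof.
rewrite -gen_alpha -(tower_adjoin alpha (leqnn n)); apply: eq_adjoin => x.
by rewrite (eq_filter (a2 := predT)) ?filter_predT // => j; apply: ltn_ord.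
Qed.

Lemma dim_tower_full : \dim (K n) = \dim {:E}.
Proof. by rewrite tower_full. Qed.

Variable T : 'Hom(E, k^o).
Hypothesis T_euler : forall y, tower_euler a n y = (T y : k)%:A.

Let scalarI : injective (fun c : k => c%:A : E).
Proof.
move=> c c' /eqP; rewrite -subr_eq0 -scalerBl scaler_eq0 oner_eq0 orbF subr_eq0.
by move/eqP.
Qed.

Lemma tower_basis0 r : tower_basis a r 0 = 1.
Proof. by elim: r => //= r IH; rewrite mod0n div0n IH mulr1. Qed.

Lemma euler_gram : @antitriangular k (\dim {:E})
  (fun i j => T (tower_basis a n i * tower_basis a n j)).
Proof.
split=> [i j|i j ltij|i j eqij]; first by rewrite mulrC.
  apply: scalarI; rewrite -T_euler scale0r.
  rewrite -dim_tower_full in ltij.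
  have [||-> //] := @tower_basis_gram _ _ a n i j.
    by apply: leq_ltn_trans (ltnW ltij); rewrite leq_addr.
  by apply: leq_ltn_trans (ltnW ltij); rewrite leq_addl.
apply: scalarI; rewrite -T_euler scale1r.
rewrite -dim_tower_full in eqij.
have [||_ -> //] := @tower_basis_gram _ _ a n i j.
  by rewrite -eqij ltnS leq_addr.
by rewrite -eqij ltnS leq_addl.
Qed.

Lemma euler_basis t : (t < \dim {:E})%N ->
  T (tower_basis a n t) = (t.+1 == \dim {:E})%:R.
Proof.
rewrite -[tower_basis _ _ t]mulr1 -[X in _ * X](tower_basis0 n).
rewrite leq_eqVlt => /orP[/eqP eq_t|lt_t].
  by rewrite (antitri1 euler_gram) ?addn0 // eq_t eqxx.
by rewrite (antitri0 euler_gram) ?addn0 // ltn_eqF.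
Qed.

Lemma euler_dual t : (t < \dim {:E})%N -> T (tower_dual a n t) = (t == 0%N)%:R.
Proof.
rewrite -dim_tower_full => ltt; apply: scalarI; rewrite -T_euler.
have [_ ->] := tower_euler_dual ltt.
by case: eqP => _; rewrite ?scale1r ?scale0r.
Qed.

(** T is 1 on the last basis monomial, and every element of E is a multiple of a nonzero u. *)
Lemma euler_nondeg u : (forall y, T (y * u) = 0) -> u = 0.
Proof.
move=> Tu0; apply/eqP/negP=> /negP u0.
have D0 := adim_gt0 (K n); rewrite dim_tower_full in D0.
have := antitri1 euler_gram (i := (\dim {:E}).-1) (j := 0%N).
rewrite addn0 prednK // => /(_ erefl).
rewrite -[X in T X](divfK u0) Tu0 => /esym/eqP.
by rewrite oner_eq0.
Qed.

(** Applying T to eta(f) = \sum_t phi(b_t) c_t keeps the term t = 0, where b_0 = 1. Hence the value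
    chosen in [Tr_omega] does not depend on phi. *)
Lemma purity_at1 phi (eta : omega alpha) : purity phi eta -> T (eta f) = phi 1.
Proof.
move=> pur; have [A [fA _]] := presentation_det pres_f.
rewrite (pur f A fA) (contract_presentation pres_f phi fA) linear_sum.
rewrite dim_tower_full big_mkord; have D0 := adim_gt0 (K n).
rewrite dim_tower_full in D0; rewrite (bigD1 (Ordinal D0)) //= big1 => [|t t0].
  by rewrite mulr_algl linearZ /= euler_dual // tower_basis0 addr0 [LHS]mulr1.
rewrite mulr_algl linearZ /= euler_dual //.
by rewrite (negPf (t0 : t != 0%N :> nat)) scaler0.
Qed.

Definition euler_omega : omega alpha := residue_omega alpha T.

(** In \sum_t T(b_t) c_t only the last term survives, and its c_t is a product of leading
    coefficients equal to 1. *)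
Lemma euler_omega_f : euler_omega f = 1.
Proof.
have [A [fA _]] := presentation_det pres_f.
rewrite -[LHS]/(residue T f) (residueE _ fA) (contract_presentation pres_f _ fA).
have D0 := adim_gt0 (K n); have Dp := prednK D0.
rewrite -{1}Dp big_nat_recr //= big_nat big1 ?add0r => [|t lt_t].
  by rewrite tower_dual_lead mulr1 euler_basis -?dim_tower_full Dp ?eqxx ?scale1r.
have lt_tD : (t.+1 < \dim (K n))%N by rewrite -Dp ltnS.
by rewrite euler_basis -?dim_tower_full 1?ltnW // ltn_eqF // scale0r mul0r.
Qed.

Lemma omega_line (eta : omega alpha) : eta = (eta f : E) *: euler_omega.
Proof.
apply/eqP; rewrite -subr_eq0; apply/eqP/val_inj/funext => g.
have : omega_fun (eta - (eta f : E) *: euler_omega) \in conormal_pred (alpha := alpha).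
  exact: valP.
move=> /asboolP/conormal_eq0; apply; first exact: pres_ideal_gen pres_f.
rewrite -[LHS]/(eta f - eta f * euler_omega f).
by rewrite euler_omega_f mulr1 subrr.
Qed.

Lemma Tr_omegaE (eta : omega alpha) : Tr_omega eta = T (eta f).
Proof.
rewrite /Tr_omega; case: pselect => [ex|no_phi].
  by case: (cid ex) => phi pur /=; rewrite (purity_at1 pur).
(* The form matched with eta is z |-> T(eta(f) z). Since [purity_scale] takes its scalars from k[t],
   eta(f) is first lifted to a polynomial p. *)
case: no_phi; have [|p eq_p] := @pres_eval_surj _ _ _ alpha n (eta f).
  by rewrite tower_full memvf.
exists (T \o amull (eta f : E))%VF; rewrite [X in purity _ X]omega_line -eq_p.
apply: (@purity_scale _ _ _ _ T) => [y|]; last exact: purity_residue.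
by rewrite comp_lfunE lfunE.
Qed.

Lemma wedge_dual_f : wedge_dual f f = 1.
Proof.
rewrite /wedge_dual; case: pselect => [ex|[]]; first by case: (cid ex).
by exists euler_omega; apply: euler_omega_f.
Qed.

Lemma dim_restr_regular : \dim {: scalar_restr (E^o : vectType E)} = \dim {:E}.
Proof. by rewrite !dimvf /dim /= mul1n. Qed.

Lemma Tr_MW_wedge_dual : Tr_MW (gen_class (wedge_dual f)) = eps_int k (\dim {:E}).
Proof.
pose w := wedge_dual f.
have omegaZ c (u : omega alpha) : (c *: u) f = c * u f by [].
have omegaD (u v : omega alpha) : (u + v) f = u f + v f by [].
have Tr_lin c (u v : omega alpha) :
    Tr_omega ((c%:A : E) *: u + v) = c * Tr_omega u + Tr_omega v.
  by rewrite !Tr_omegaE omegaD omegaZ mulr_algl linearP.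
have Tr_nondeg (u : omega alpha) :
    (forall c, Tr_omega (c *: u) = 0) -> u = 0.
  move=> u0; rewrite [u]omega_line (@euler_nondeg (u f)) ?scale0r // => y.
  by rewrite -[RHS](u0 y) Tr_omegaE omegaZ.
have ipw : inner_product (fun x y : E^o => (x * y : E) *: w).
  split=> [c x y z|x y|x x0].
  - by rewrite mulrDl scalerDl -scalerAl -[c *: (x * z)]/(c * (x * z)) scalerA.
  - by rewrite mulrC.
  have := congr1 (fun u : omega alpha => u f) (x0 1).
  by rewrite -[LHS]/(x * 1 * wedge_dual f f) wedge_dual_f !mulr1.
rewrite /Tr_MW /gen_class (transferE Tr_lin Tr_nondeg ipw).
rewrite -(gw_antitriangular euler_gram).
have ipT := transfer_formP Tr_lin Tr_nondeg ipw.
apply: gw_isometric => //; first exact/gram_formP/euler_gram.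
apply: isometric_sym.
(* As w(f) = 1, the transferred form is (x, y) |-> T(x y), whose Gram matrix on the monomials is
   that of [euler_gram]. *)
apply: (gram_isometric (v := fun i => tower_basis a n i : scalar_restr E^o)) => //.
- exact: dim_restr_regular.
- exact: euler_gram.
- move=> i j _ _; rewrite /transfer_form Tr_omegaE omegaZ wedge_dual_f.
  by rewrite mulr1.
Qed.

End Trace.

Theorem corollary4p4p10 (k : fieldType) (E : fieldExtType k) (d n : nat)
    (alpha : 'I_n -> E) (f : 'I_n -> pres_ideal alpha) :
  \dim {:E} = d -> minimal_generators alpha -> presentation f ->
  Tr_MW (gen_class (wedge_dual f)) = eps_int k d.
Proof.
move=> <- [gen_alpha _] pres_f.
have [T T_euler] := tower_euler_scalar (tower_full gen_alpha).
exact: Tr_MW_wedge_dual pres_f gen_alpha T T_euler.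
Qed.
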